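(* Let $(M,J,g)$ be a Kähler-Norden manifold with $\dim M\ge 4$, let $\nabla$ be the Levi-Civita connection of $g$, and let $c$ be a symmetric $(0,2)$-tensor field on $M$. Then the cotangent bundle $T^{\ast}M$ equipped with the modified Riemannian extension $\widetilde g_{\nabla,c}$ and the almost complex structure ${}^{H}J$ (the horizontal lift of $J$ with respect to $\nabla$) is a Kähler-Norden manifold if and only if $c$ is a holomorphic tensor field with respect to $J$.
   Context: All objects are $C^\infty$. An almost complex Norden manifold $(M,J,g)$ is an even-dimensional manifold $M$ (say $\dim M=2k$) with an almost complex structure $J$ ($J^2=-\mathrm{id}$) and a pseudo-Riemannian metric $g$ of neutral signature $(k,k)$ such that $g(JX,Y)=g(X,JY)$ for all vector fields $X,Y$. It is a Kähler-Norden (anti-Kähler) manifold if moreover $\nabla J=0$, where $\nabla$ is the Levi-Civita connection of $g$. A $(0,2)$-tensor field $t$ is pure with respect to $J$ if $t(JX,Y)=t(X,JY)$ for all $X,Y$. For a pure $t$ the Tachibana operator is $$(\Phi_J t)(X,Y,Z)=(JX)(t(Y,Z))-X(t(JY,Z))+t((L_YJ)X,Z)+t(Y,(L_ZJ)X),$$ where $L$ is the Lie derivative. A symmetric $(0,2)$-tensor field $c$ is holomorphic with respect to $J$ if it is pure with respect to $J$ and $\Phi_J c=0$. Local coordinates $x^i$ on $U\subset M$ induce coordinates $(x^i,p_i)$ on $\pi^{-1}(U)\subset T^{\ast}M$, where $\pi:T^{\ast}M\to M$ is the projection and $p_i$ are the components of covectors in the coframe $dx^i$. Let $\Gamma^h_{ij}$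 be the coefficients of $\nabla$. For a vector field $X=X^i\partial_{x^i}$ and a 1-form $\omega=\omega_i dx^i$ on $M$, the horizontal lift is ${}^{H}X=X^i\partial_{x^i}+p_h\Gamma^h_{ij}X^j\partial_{p_i}$ and the vertical lift is ${}^{V}\omega=\omega_i\partial_{p_i}$. The horizontal lift ${}^{H}J$ of $J$ is the $(1,1)$-tensor field on $T^{\ast}M$ with ${}^{H}J({}^{H}X)={}^{H}(JX)$ and ${}^{H}J({}^{V}\omega)={}^{V}(\omega\circ J)$; it is an almost complex structure on $T^{\ast}M$. The modified Riemannian extension $\widetilde g_{\nabla,c}$ is the pseudo-Riemannian metric on $T^{\ast}M$ with $\widetilde g_{\nabla,c}({}^{H}X,{}^{H}Y)=c(X,Y)$, $\widetilde g_{\nabla,c}({}^{H}X,{}^{V}\omega)=\widetilde g_{\nabla,c}({}^{V}\omega,{}^{H}X)=\omega(X)$, $\widetilde g_{\nabla,c}({}^{V}\omega,{}^{V}\theta)=0$. *)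

(* Defs.v *)
From HB Require Import structures.
From mathcomp Require Import all_boot all_order all_algebra.
From mathcomp Require Import all_classical all_reals all_analysis.
Set Implicit Arguments.
Unset Strict Implicit.
Unset Printing Implicit Defensive.
Import Order.TTheory GRing.Theory Num.Theory.
Import numFieldNormedType.Exports.
Local Open Scope classical_set_scope.
Local Open Scope ring_scope.

(* Conventions.  The smooth structure of a manifold is given by an atlas, and a
   tensor field is the family of its component functions in the charts, as
   functions of the coordinates, subject to the classical transformation law.
   Vectors are ROW vectors: a (1,1)-tensor J acts on a vector v by v *m J, so
   the entry J a b is the component usually written J^b_a. *)

Section SmoothMaps.
Context {R : realType} {V W : normedModType R}.

Fixpoint class_C (m : nat) (U : set V) (f : V -> W) : Prop :=
  if m is m'.+1 then
    (forall x, U x -> differentiable f x) /\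
    (forall v, class_C m' U ('D_v f))
  else forall x, U x -> {for x, continuous f}.

Definition smooth (U : set V) (f : V -> W) := forall m, class_C m U f.

End SmoothMaps.

Section Manifolds.
Context {R : realType} {n : nat}.

Record atlas (M : Type) := Atlas {
  idx : Type;
  dom : idx -> set M;
  coord : idx -> M -> 'rV[R]_n
}.

Context {M : topologicalType}.
Context (A : atlas M).

Definition cod (i : idx A) : set 'rV[R]_n := coord i @` dom i.

Definition overlap (i j : idx A) : set 'rV[R]_n :=
  coord i @` (dom i `&` dom j).

(* The junk value 0 is only taken outside [overlap i j]. *)
Definition transition (i j : idx A) (y : 'rV[R]_n) : 'rV[R]_n :=
  xget 0 [set coord j x |
          x in [set x | [/\ dom i x, dom j x & coord i x = y]]].

Definition is_manifold : Prop :=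
  [/\ hausdorff_space M,
      @second_countable M,
      forall x : M, exists i : idx A, dom i x,
      forall i : idx A,
        [/\ open (dom i),
            set_inj (dom i) (coord i),
            forall x, dom i x -> {for x, continuous (coord i)} &
            forall O : set M, open O -> O `<=` dom i -> open (coord i @` O)]
    & forall i j : idx A, smooth (overlap i j) (transition i j)].

(* Entry (a, b) is the derivative of the b-th new coordinate with respect to
   the a-th old one. *)
Definition tjac (i j : idx A) (y : 'rV[R]_n) : 'M[R]_n := 'J (transition i j) y.

Definition mx_field := idx A -> 'rV[R]_n -> 'M[R]_n.

Definition is_tensor11 (J : mx_field) : Prop :=
  (forall i, smooth (cod i) (J i)) /\
  (forall i j y, overlap i j y ->
     J i y *m tjac i j y = tjac i j y *m J j (transition i j y)).

Definition is_tensor02 (t : mx_field) : Prop :=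
  (forall i, smooth (cod i) (t i)) /\
  (forall i j y, overlap i j y ->
     t i y = tjac i j y *m t j (transition i j y) *m (tjac i j y)^T).

End Manifolds.

Arguments atlas : clear implicits.

Section LocalCalculus.
Context {R : realType} {n : nat}.
Implicit Types (v w om : 'rV[R]_n) (y : 'rV[R]_n).
Implicit Types (X Y Z : 'rV[R]_n -> 'rV[R]_n) (J t g : 'rV[R]_n -> 'M[R]_n).

Definition bil (B : 'M[R]_n) v w : R := (v *m B *m w^T) 0 0.

Definition pairing om v : R := (om *m v^T) 0 0.

Definition act J X : 'rV[R]_n -> 'rV[R]_n := fun y => X y *m J y.

Definition bilf t X Y : 'rV[R]_n -> R^o := fun y => bil (t y) (X y) (Y y).

Definition bracket X Y : 'rV[R]_n -> 'rV[R]_n :=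
  fun y => 'D_(X y) Y y - 'D_(Y y) X y.

(* lieJ Y J X is (L_Y J) X *)
Definition lieJ Y J X : 'rV[R]_n -> 'rV[R]_n :=
  fun y => bracket Y (act J X) y - act J (bracket Y X) y.

Definition tachibana J t X Y Z : 'rV[R]_n -> R := fun y =>
  'D_(act J X y) (bilf t Y Z) y - 'D_(X y) (bilf t (act J Y) Z) y
  + bilf t (lieJ Y J X) Z y + bilf t Y (lieJ Z J X) y.

(* christoffel g y h a b is the coefficient Gamma^h_ab at y. *)
Definition christoffel g y (h a b : 'I_n) : R :=
  let d k i j := 'D_(delta_mx 0 k) (fun z => g z i j : R^o) y in
  2^-1 * \sum_(l < n) invmx (g y) h l * (d a b l + d b a l - d l a b).

(* levi_civita g X Y is the field nabla_X Y, nabla the Levi-Civita connection of g. *)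
Definition levi_civita g X Y : 'rV[R]_n -> 'rV[R]_n := fun y =>
  'D_(X y) Y y +
  \row_h \sum_(a < n) \sum_(b < n) christoffel g y h a b * X y 0 a * Y y 0 b.

(* For even n: the signature of the symmetric form G is (n/2, n/2). *)
Definition neutral_signature (G : 'M[R]_n) : Prop :=
  exists2 P : 'M[R]_n, P \in unitmx &
    P *m G *m P^T = diag_mx (\row_(j < n) (if (j < n./2)%N then 1 else -1)).

End LocalCalculus.

Section NordenManifolds.
Context {R : realType} {n : nat} {M : topologicalType}.
Context (A : atlas R n M).
Implicit Types J t g : mx_field A.

Definition symmetric_tensor t : Prop :=
  forall i y, cod i y -> forall v w, bil (t i y) v w = bil (t i y) w v.

Definition pure J t : Prop :=
  forall i y, cod i y -> forall v w,
    bil (t i y) (v *m J i y) w = bil (t i y) v (w *m J i y).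

(* X is the component function, in the chart i, of a smooth vector field on an
   open subset of its domain; U is the image of that subset. *)
Definition local_fields (i : idx A) (U : set 'rV[R]_n)
    (X : 'rV[R]_n -> 'rV[R]_n) : Prop :=
  [/\ open U, U `<=` cod i & smooth U X].

Definition holomorphic J t : Prop :=
  pure J t /\
  forall i U X Y Z,
    local_fields i U X -> local_fields i U Y -> local_fields i U Z ->
    forall y, U y -> tachibana (J i) (t i) X Y Z y = 0.

Definition almost_complex_norden J g : Prop :=
  [/\ is_manifold A /\ ~~ odd n,
      is_tensor11 J /\ (forall i y, cod i y -> J i y *m J i y = - 1%:M),
      is_tensor02 g /\ symmetric_tensor g,
      forall i y, cod i y -> neutral_signature (g i y)
    & pure J g].

Definition kahler_norden J g : Prop :=
  almost_complex_norden J g /\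
  forall i U X Y, local_fields i U X -> local_fields i U Y ->
    forall y, U y ->
      levi_civita (g i) X (act (J i) Y) y =
      act (J i) (levi_civita (g i) X Y) y.

End NordenManifolds.

Section CotangentBundle.
Context {R : realType} {n : nat} {M : topologicalType}.

(* A covector at [base] is the family of its components p_i in the coframes
   dx^i of the charts around [base]; the components in the other charts are set
   to 0 so that equal covectors are Leibniz equal. *)
Record cotangent (A : atlas R n M) := Covector {
  base : M;
  comp : idx A -> 'rV[R]_n;
  comp_out : forall i, ~ dom i base -> comp i = 0;
  comp_change : forall i j, dom i base -> dom j base ->
    comp i = comp j *m (tjac i j (coord i base))^T
}.

Definition cot_coord (A : atlas R n M) (i : idx A) (xi : cotangent A) :
  'rV[R]_(n + n) := row_mx (coord i (base xi)) (comp xi i).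

HB.instance Definition _ (A : atlas R n M) := gen_eqMixin (cotangent A).
HB.instance Definition _ (A : atlas R n M) := gen_choiceMixin (cotangent A).

Definition cot_subbase (A : atlas R n M) : set (set (cotangent A)) :=
  [set W | exists i (O : set 'rV[R]_(n + n)),
     open O /\ W = [set xi | dom i (base xi) /\ O (cot_coord i xi)]].

HB.instance Definition _ (A : atlas R n M) :=
  isSubBaseTopological.Build (cotangent A) (@cot_subbase A) id.

Definition cot_atlas (A : atlas R n M) : atlas R (n + n) (cotangent A) :=
  {| idx := idx A;
     dom := fun i => [set xi | dom i (base xi)];
     coord := @cot_coord A |}.

End CotangentBundle.

Section Lifts.
Context {R : realType} {n : nat}.
Implicit Types (v w om th p x : 'rV[R]_n) (g J c : 'rV[R]_n -> 'M[R]_n).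

(* Lifts at the covector with induced coordinates (x, p). *)
Definition hlift g x p v : 'rV[R]_(n + n) :=
  row_mx v (\row_i \sum_(h < n) \sum_(j < n)
                     p 0 h * christoffel g x h i j * v 0 j).

Definition vlift om : 'rV[R]_(n + n) := row_mx 0 om.

(* Rows: horizontal lifts of the coordinate vectors, then vertical lifts of the
   coordinate covectors. *)
Definition adapted_frame g x p : 'M[R]_(n + n) :=
  col_mx (\matrix_(i < n) hlift g x p (delta_mx 0 i))
         (\matrix_(i < n) vlift (delta_mx 0 i)).

Definition hlift_mx g J (z : 'rV[R]_(n + n)) : 'M[R]_(n + n) :=
  let x := lsubmx z in
  let F := adapted_frame g x (rsubmx z) in
  invmx F *m block_mx (J x) 0 0 (J x)^T *m F.

Definition riem_ext_mx g c (z : 'rV[R]_(n + n)) : 'M[R]_(n + n) :=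
  let x := lsubmx z in
  let F := adapted_frame g x (rsubmx z) in
  invmx F *m block_mx (c x) 1%:M 1%:M 0 *m (invmx F)^T.

Lemma adapted_frameE g x p : adapted_frame g x p =
  block_mx 1%:M (\matrix_(j, i) \sum_(h < n) p 0 h * christoffel g x h i j)
           0 1%:M.
Proof.
rewrite /block_mx; congr col_mx; apply/row_matrixP => k;
  rewrite rowK row_row_mx row1 ?row0 // /hlift.
congr row_mx; apply/rowP => i; rewrite !mxE exchange_big (bigD1 k) //=.
rewrite [X in _ + X]big1 => [|j jk].
  by rewrite addr0; apply: eq_bigr => h _; rewrite mxE !eqxx mulr1.
by rewrite big1 // => h _; rewrite mxE (negbTE jk) andbF mulr0.
Qed.

Lemma adapted_frame_unit g x p : adapted_frame g x p \in unitmx.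
Proof. by rewrite adapted_frameE unitmxE det_ublock !det1 mulr1 unitr1. Qed.

Lemma hlift_frame g x p v :
  hlift g x p v = row_mx v 0 *m adapted_frame g x p.
Proof.
rewrite adapted_frameE mul_row_block !mulmx1 !mul0mx !addr0; congr row_mx.
apply/rowP => i; rewrite !mxE exchange_big; apply: eq_bigr => j _ /=.
by rewrite mxE mulr_sumr; apply: eq_bigr => h _; rewrite mulrC.
Qed.

Lemma vlift_frame g x p om : vlift om = row_mx 0 om *m adapted_frame g x p.
Proof. by rewrite adapted_frameE mul_row_block !mul0mx mulmx0 mulmx1 !add0r. Qed.

(* The defining properties of the horizontal lift of J and of the modified
   Riemannian extension. *)

Lemma pairing_comp om v (B : 'M[R]_n) : pairing (om *m B^T) v = pairing om (v *m B).
Proof. by rewrite /pairing trmx_mul mulmxA. Qed.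

Let frame_mul g x p (u : 'rV[R]_(n + n)) (D : 'M[R]_(n + n)) :
  let F := adapted_frame g x p in
  u *m F *m (invmx F *m D *m F) = u *m D *m F.
Proof. by move=> F; rewrite !mulmxA mulmxK ?adapted_frame_unit. Qed.

Let frame_bil g x p (u u' : 'rV[R]_(n + n)) (B : 'M[R]_(n + n)) :
  let F := adapted_frame g x p in
  bil (invmx F *m B *m (invmx F)^T) (u *m F) (u' *m F) = bil B u u'.
Proof.
move=> F; rewrite /bil !mulmxA mulmxK ?adapted_frame_unit // -!mulmxA.
by rewrite -trmx_mul mulmxK ?adapted_frame_unit.
Qed.

Lemma hlift_mx_hlift g J x p v :
  hlift g x p v *m hlift_mx g J (row_mx x p) = hlift g x p (v *m J x).
Proof.
rewrite !hlift_frame /hlift_mx row_mxKl row_mxKr frame_mul.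
by rewrite mul_row_block !mul0mx mulmx0 !addr0.
Qed.

Lemma hlift_mx_vlift g J x p om :
  vlift om *m hlift_mx g J (row_mx x p) = vlift (om *m (J x)^T).
Proof.
rewrite !(vlift_frame g x p) /hlift_mx row_mxKl row_mxKr frame_mul.
by rewrite mul_row_block !mul0mx mulmx0 !add0r.
Qed.

Lemma riem_ext_hh g c x p v w :
  bil (riem_ext_mx g c (row_mx x p)) (hlift g x p v) (hlift g x p w) =
  bil (c x) v w.
Proof.
rewrite !hlift_frame /riem_ext_mx row_mxKl row_mxKr frame_bil /bil.
by rewrite mul_row_block tr_row_mx mul_row_col trmx0 !mul0mx mulmx0 !addr0.
Qed.

Lemma riem_ext_hv g c x p v om :
  bil (riem_ext_mx g c (row_mx x p)) (hlift g x p v) (vlift om) =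
  pairing om v.
Proof.
rewrite hlift_frame (vlift_frame g x p) /riem_ext_mx row_mxKl row_mxKr.
rewrite frame_bil /bil mul_row_block tr_row_mx mul_row_col trmx0 mulmx0.
rewrite mulmx1 mul0mx addr0 add0r /pairing -[in RHS](trmxK (om *m _)).
by rewrite trmx_mul trmxK [RHS]mxE.
Qed.

Lemma riem_ext_vh g c x p v om :
  bil (riem_ext_mx g c (row_mx x p)) (vlift om) (hlift g x p v) =
  pairing om v.
Proof.
rewrite hlift_frame (vlift_frame g x p) /riem_ext_mx row_mxKl row_mxKr.
rewrite frame_bil /bil mul_row_block tr_row_mx mul_row_col trmx0 mulmx0.
by rewrite mulmx1 mul0mx addr0 add0r.
Qed.

Lemma riem_ext_vv g c x p om th :
  bil (riem_ext_mx g c (row_mx x p)) (vlift om) (vlift th) = 0.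
Proof.
rewrite !(vlift_frame g x p) /riem_ext_mx row_mxKl row_mxKr frame_bil /bil.
rewrite mul_row_block tr_row_mx mul_row_col trmx0 !mulmx0 !mul0mx !addr0.
by rewrite mul0mx addr0 mxE.
Qed.

End Lifts.

Section CotangentTensors.
Context {R : realType} {n : nat} {M : topologicalType} (A : atlas R n M).

Definition horizontal_lift (g J : mx_field A) : mx_field (cot_atlas A) :=
  fun i => hlift_mx (g i) (J i).

Definition riem_ext (g c : mx_field A) : mx_field (cot_atlas A) :=
  fun i => riem_ext_mx (g i) (c i).

End CotangentTensors.

(* Main.v *)
Require Import Defs.
From HB Require Import structures.
From mathcomp Require Import all_boot all_order all_algebra.
From mathcomp Require Import ring lra.
From mathcomp Require Import all_classical all_reals all_analysis.
Set Implicit Arguments.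
Unset Strict Implicit.
Unset Printing Implicit Defensive.
Import Order.TTheory GRing.Theory Num.Theory.
Import numFieldNormedType.Exports.
(* [coord] would otherwise denote vector coordinates. *)
Import Defs.
Local Open Scope classical_set_scope.
Local Open Scope ring_scope.

(* For a metric g with g J = J g, write [ab,l] for its Christoffel symbols of
   the first kind; then nabla J = 0 is the inverse-free condition
   (d_a J) g + J [a.,.] = [a.,.] J^T.  For the modified Riemannian extension
   every block of this condition holds identically, except the
   horizontal-horizontal one along d/dx^a.  There the terms depending on the
   fibre coordinates p say that p R(X,Y)Z is pure in X, Y, which follows from
   R J = J R and the pair symmetry of R, and what remains is the same
   condition with c in place of g.  With Phi the Tachibana operator of c, that
   remainder is Phi(b;a,l) + Phi(l;a,b) = 0, and it forces Phi = 0 because Phi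
   is symmetric in its last two arguments.
   The lifts are tensor fields on the cotangent bundle because the adapted
   frames of two charts differ by diag(T, T^-T), T the Jacobian matrix of the
   change of coordinates; this is the transformation law of the Christoffel
   symbols. *)

(** * Smooth maps *)

(** Why first-kind symbols: with [N b l] = p_h Gamma^h_bl, those of the extension contain only first
    derivatives of c and [N], whereas its inverse metric would multiply them by c and [N] again. Why
    curvature appears: the base derivatives of [N] carry the derivatives of Gamma, and the products
    of [N] with Gamma supply the quadratic terms, so that together they form p_h R^h. The identity R
    J = J R and the skewness behind the pair symmetry both come from commuting second derivatives,
    of J and of g, after their first derivatives have been expressed through Gamma; hence the need
    for Schwarz's theorem. The algebra treats derivatives as independent matrices bound by such
    differentiated identities, and the calculus in a chart supplies these identities. The remaining
    condition on c does not contain p. In one direction it can therefore be read off at the zero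
    covector, and in the other it gives parallelism on the whole fibre. *)

Section ClassC.
Context {R : realType} {V : normedModType R}.
Implicit Types (U : set V).

Lemma open_near_eq (W : Type) U (f g : V -> W) x :
  open U -> (forall y, U y -> f y = g y) -> U x -> \near x, f x = g x.
Proof.
move=> oU fg Ux; have : nbhs x U by apply: open_nbhs_nbhs.
by apply: filterS => y /fg.
Qed.

(** The first-order expansion of [f] at [x] is also one of [g], and such an expansion determines the
    differential. *)
Lemma near_eq_differentiable (W : normedModType R) (f g : V -> W) x :
  (\near x, f x = g x) -> differentiable f x -> differentiable g x.
Proof.
move=> fg df; have [cd /eqaddoP fE] := (diff_locallyP _ _).1 df.
have fgx : f x = g x := nbhs_singleton fg.
have gE : g \o shift x = cst (g x) + 'd f x +o_ 0 id.
  apply/eqaddoP => e e0; move: fg; rewrite (near_shift 0) subr0 => fg.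
  near=> h; have -> : (g \o shift x - (cst (g x) + 'd f x)) h =
      (f \o shift x - (cst (f x) + 'd f x)) h.
    by rewrite !fctE /= fgx; congr (_ - _); symmetry; near: h.
  by near: h; exact: fE.
apply/diff_locallyP.
by rewrite (diff_unique cd gE).
Unshelve. all: by end_near. Qed.

(** Openness of [U] carries the induction: agreement on [U] is agreement near each of its points,
    hence passes to the directional derivatives. *)
Lemma class_C_congr (W : normedModType R) m U (f g : V -> W) :
  open U -> (forall x, U x -> f x = g x) -> class_C m U f -> class_C m U g.
Proof.
move=> oU; elim: m f g => [|m IH] f g fg /= Cf.
  move=> x Ux; have nfg := open_near_eq oU fg Ux.
  have := Cf _ Ux; rewrite /prop_for /continuous_at -(fg x Ux).
  apply: cvg_trans; apply: near_eq_cvg; near=> y; near: y; exact: nfg.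
case: Cf => df Cf; split.
  move=> x Ux; exact: near_eq_differentiable (open_near_eq oU fg Ux) (df x Ux).
move=> v; apply: IH (Cf v) => x Ux.
exact: near_eq_derive (open_near_eq oU fg Ux).
Unshelve. all: by end_near. Qed.

Lemma class_CS (W : normedModType R) m U (f : V -> W) :
  class_C m.+1 U f -> class_C m U f.
Proof.
elim: m f => [|m IH] f [df Cf]; first by move=> x Ux; exact: differentiable_continuous (df x Ux).
by split=> // v; apply: IH.
Qed.

Lemma class_C_cst (W : normedModType R) m U (w : W) : class_C m U (cst w : V -> W).
Proof.
elim: m w => [|m IH] w /=; first by move=> x _; exact: cst_continuous.
split=> [x _|v]; first exact: differentiable_cst.
have -> : 'D_v (cst w : V -> W) = cst 0 by apply/funext => x; rewrite derive_cst.
exact: IH.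
Qed.

Lemma class_C_linear (W W' : normedModType R) (L : {linear W -> W'}) m U
    (f : V -> W) :
  continuous L -> open U -> class_C m U f -> class_C m U (L \o f).
Proof.
move=> cL oU; elim: m f => [|m IH] f /= Cf.
  by move=> x Ux; apply: continuous_comp; [exact: Cf | exact: cL].
case: Cf => df Cf.
have dL y : differentiable L y by exact: linear_differentiable.
split=> [x Ux|v]; first exact: differentiable_comp (df _ Ux) (dL _).
apply: class_C_congr oU _ (IH _ (Cf v)) => x Ux /=.
rewrite (deriveE _ (df _ Ux)) (deriveE _ (differentiable_comp (df _ Ux) (dL _))).
rewrite (diff_comp (df _ Ux) (dL _)) /=.
by rewrite (diff_lin _ cL).
Qed.

Lemma class_CD (W : normedModType R) m U (f g : V -> W) :
  open U -> class_C m U f -> class_C m U g -> class_C m U (f + g).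
Proof.
move=> oU; elim: m f g => [|m IH] f g /= Cf Cg.
  by move=> x Ux; apply: continuousD; [exact: Cf | exact: Cg].
case: Cf Cg => df Cf [dg Cg]; split=> [x Ux|v].
  exact: differentiableD (df _ Ux) (dg _ Ux).
apply: class_C_congr oU _ (IH _ _ (Cf v) (Cg v)) => x Ux.
by rewrite deriveD //; apply: diff_derivable; [exact: df | exact: dg].
Qed.

Lemma class_C_sum (W : normedModType R) (I : Type) (r : seq I) (P : pred I) m U
    (f : I -> V -> W) :
  open U -> (forall i, P i -> class_C m U (f i)) ->
  class_C m U (\sum_(i <- r | P i) f i).
Proof.
move=> oU Cf; elim/big_ind: _ => //; first exact: class_C_cst.
by move=> ? ?; exact: class_CD.
Qed.

Lemma class_CM m U (f g : V -> R) :
  open U -> class_C m U f -> class_C m U g -> class_C m U (f * g).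
Proof.
move=> oU; elim: m f g => [|m IH] f g Cf Cg.
  by move=> x Ux; apply: continuousM; [exact: Cf | exact: Cg].
have [Cf0 Cg0] := (class_CS Cf, class_CS Cg).
case: Cf Cg => df Cf [dg Cg]; split=> [x Ux|v].
  exact: differentiableM (df _ Ux) (dg _ Ux).
apply: class_C_congr oU _ (class_CD oU (IH _ _ Cf0 (Cg v)) (IH _ _ Cg0 (Cf v))) => x Ux.
by rewrite deriveM //; apply: diff_derivable; [exact: df | exact: dg].
Qed.

(** The derivative of 1/f is -(1/f)(1/f)f', so regularity of order m of 1/f itself yields the next
    order. *)
Lemma class_CV m U (f : V -> R) :
  open U -> (forall x, U x -> f x != 0) -> class_C m U f ->
  class_C m U (fun x => (f x)^-1).
Proof.
move=> oU f0; elim: m => [|m IH] Cf.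
  by move=> x Ux; apply: continuousV; [exact: f0 | exact: Cf].
have CfV := IH (class_CS Cf); case: Cf => df Cf; split=> [x Ux|v].
  exact: differentiableV (df _ Ux) (f0 _ Ux).
have CfN : class_C m U (cst (-1) : V -> R) by exact: class_C_cst.
apply: class_C_congr oU _ (class_CM oU (class_CM oU CfN (class_CM oU CfV CfV)) (Cf v)) => x Ux.
rewrite (deriveV (f0 _ Ux)) /=; last by apply: diff_derivable; exact: df.
by rewrite !fctE mulN1r -invfM -expr2.
Qed.

Lemma differentiable_mxP p q (f : V -> 'M[R]_(p, q)) x :
  differentiable f x <-> forall i j, differentiable (fun y => f y i j) x.
Proof.
split=> [df i j|df].
  exact: differentiable_comp df (differentiable_coord _ _ _).
have -> : f = \sum_i \sum_j (fun y => f y i j *: delta_mx i j).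
  apply/funext => y; rewrite [LHS]matrix_sum_delta fct_sumE.
  by apply: eq_bigr => i _; rewrite fct_sumE.
by apply: differentiable_sum => i; apply: differentiable_sum => j; exact: differentiableZl.
Qed.

Lemma derive_mxE p q (f : V -> 'M[R]_(p, q)) v x i j :
  differentiable f x -> 'D_v f x i j = 'D_v (fun y => f y i j) x.
Proof. by move=> df; rewrite derive_mx ?mxE //; exact: diff_derivable. Qed.

Lemma class_C_coord p q m U (f : V -> 'M[R]_(p, q)) i j :
  open U -> class_C m U f -> class_C m U (fun y => f y i j).
Proof.
move=> oU Cf.
(* The entry map, bundled as a linear map for [class_C_linear]. *)
have @L : {linear 'M[R]_(p, q) -> R}.
  by exists (fun N : 'M[R]_(_, _) => N i j); do 2![eexists]; do ?[constructor];
     rewrite ?mxE// => ? *; rewrite ?mxE//; move=> ?; rewrite !mxE.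
by apply: (class_C_linear (L := L)) => //; exact: coord_continuous.
Qed.

Lemma class_C_scalel (W : normedModType R) m U (f : V -> R) (w : W) :
  open U -> class_C m U f -> class_C m U (fun y => f y *: w).
Proof.
move=> oU Cf.
have sw_lin : linear ( *:%R ^~ w : R -> W) by move=> a x y; rewrite scalerDl scalerA.
pose swlM := GRing.isLinear.Build _ _ _ _ _ sw_lin.
pose L : {linear R -> W} := HB.pack ( *:%R ^~ w) swlM.
by apply: (class_C_linear (L := L)) => //; exact: scalel_continuous.
Qed.

Lemma class_C_mxP p q m U (f : V -> 'M[R]_(p, q)) : open U ->
  class_C m U f <-> forall i j, class_C m U (fun y => f y i j).
Proof.
move=> oU; split=> [Cf i j|Cf]; first exact: class_C_coord.
have -> : f = \sum_i \sum_j (fun y => f y i j *: delta_mx i j).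
  apply/funext => y; rewrite [LHS]matrix_sum_delta fct_sumE.
  by apply: eq_bigr => i _; rewrite fct_sumE.
by apply: class_C_sum => // i _; apply: class_C_sum => // j _; exact: class_C_scalel.
Qed.

End ClassC.

Lemma derive_rowE {R : realType} {n : nat} {W : normedModType R}
    (f : 'rV[R]_n -> W) (v x : 'rV[R]_n) :
  differentiable f x -> 'D_v f x = \sum_a v 0 a *: 'D_(delta_mx 0 a) f x.
Proof.
move=> df; rewrite deriveE // [in LHS](row_sum_delta v) linear_sum.
by apply: eq_bigr => a _; rewrite linearZ deriveE.
Qed.

Lemma derive_comp_rowE {R : realType} {V W : normedModType R} {n : nat}
    (f : V -> 'rV[R]_n) (g : 'rV[R]_n -> W) v x :
  differentiable f x -> differentiable g (f x) ->
  'D_v (g \o f) x = \sum_a 'D_v f x 0 a *: 'D_(delta_mx 0 a) g (f x).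
Proof.
move=> df dg; rewrite (deriveE _ (differentiable_comp df dg)) diff_comp //=.
by rewrite -(deriveE _ df) -derive_rowE // (deriveE _ dg).
Qed.

Section Comp.
Context {R : realType} {V : normedModType R}.

(** The chain rule replaces [g] by its partial derivatives and keeps [f] inside, so the induction
    hypothesis has to range over all [g]. *)
Lemma class_C_comp n m U O (f : V -> 'rV[R]_n) (g : 'rV[R]_n -> R) :
  open U -> open O -> (forall x, U x -> O (f x)) ->
  class_C m U f -> class_C m O g -> class_C m U (g \o f).
Proof.
move=> oU oO UO; elim: m f g UO => [|m IH] f g UO Cf Cg.
  by move=> x Ux; apply: continuous_comp; [exact: Cf | exact/Cg/UO].
have Cf0 := class_CS Cf.
case: Cf Cg => df Cf [dg Cg]; split=> [x Ux|v].
  exact: differentiable_comp (df _ Ux) (dg _ (UO _ Ux)).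
have C1 : class_C m U
    (\sum_a ((fun y => 'D_v f y 0 a) * ('D_(delta_mx 0 a) g \o f))).
  apply: class_C_sum => // a _; apply: class_CM => //.
    exact: (class_C_coord _ _ oU (Cf v)).
  exact: (IH f _ UO Cf0 (Cg _)).
apply: class_C_congr oU _ C1 => x Ux.
by rewrite (derive_comp_rowE _ (df _ Ux) (dg _ (UO _ Ux))) fct_sumE.
Qed.

End Comp.

Section Smooth.
Context {R : realType} {V : normedModType R}.
Variables (U : set V) (oU : open U).

Lemma smooth_congr (W : normedModType R) (f g : V -> W) :
  (forall x, U x -> f x = g x) -> smooth U f -> smooth U g.
Proof. by move=> fg Cf m; exact: class_C_congr (Cf m). Qed.

Lemma smooth_differentiable (W : normedModType R) (f : V -> W) x :
  smooth U f -> U x -> differentiable f x.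
Proof. by move=> /(_ 1%N) [df _] /df. Qed.

Lemma smooth_continuous (W : normedModType R) (f : V -> W) x :
  smooth U f -> U x -> {for x, continuous f}.
Proof. by move=> /(_ 0%N) Cf /Cf. Qed.

Lemma smooth_derive (W : normedModType R) (f : V -> W) v :
  smooth U f -> smooth U ('D_v f).
Proof. by move=> Cf m; have [_] := Cf m.+1; exact. Qed.

Lemma smooth_cst (W : normedModType R) (w : W) : smooth U (cst w).
Proof. by move=> m; exact: class_C_cst. Qed.

Lemma smooth_linear (W W' : normedModType R) (L : {linear W -> W'}) (f : V -> W) :
  continuous L -> smooth U f -> smooth U (L \o f).
Proof. by move=> cL Cf m; exact: class_C_linear. Qed.

Lemma smooth_id : smooth U id.
Proof.
case=> [|m]; first by move=> x _; exact: cvg_id.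
split=> [x _ //|v].
have -> : 'D_v (id : V -> V) = cst v by apply/funext => x; rewrite derive_id.
exact: class_C_cst.
Qed.

Lemma smooth_mxP p q (f : V -> 'M[R]_(p, q)) :
  smooth U f <-> forall i j, smooth U (fun y => f y i j).
Proof.
split=> [Cf i j m|Cf m]; first exact: (class_C_coord _ _ oU (Cf m)).
by apply/(class_C_mxP _ _ oU) => i j; exact: Cf.
Qed.

Lemma smoothM (f g : V -> R) :
  smooth U f -> smooth U g -> smooth U (fun x => f x * g x).
Proof. by move=> Cf Cg m; exact: class_CM (Cf m) (Cg m). Qed.

Lemma smoothV (f : V -> R) : (forall x, U x -> f x != 0) ->
  smooth U f -> smooth U (fun x => (f x)^-1).
Proof. by move=> f0 Cf m; exact: class_CV (Cf m). Qed.

Lemma smoothD (W : normedModType R) (f g : V -> W) :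
  smooth U f -> smooth U g -> smooth U (fun x => f x + g x).
Proof. by move=> Cf Cg m; exact: class_CD (Cf m) (Cg m). Qed.

Lemma smooth_sum (W : normedModType R) (I : Type) (r : seq I) (P : pred I)
    (f : I -> V -> W) : (forall i, P i -> smooth U (f i)) ->
  smooth U (fun x => \sum_(i <- r | P i) f i x).
Proof.
move=> Cf m; rewrite -[X in class_C _ _ X](fct_sumE _ _ _).
by apply: class_C_sum => // i Pi; exact: Cf.
Qed.

Lemma smooth_prod (I : Type) (r : seq I) (P : pred I)
    (f : I -> V -> R) : (forall i, P i -> smooth U (f i)) ->
  smooth U (fun x => \prod_(i <- r | P i) f i x).
Proof.
move=> Cf; elim: r => [|i r IH].
  by apply: smooth_congr (smooth_cst (1 : R)) => x _; rewrite big_nil.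
have [Pi|nPi] := boolP (P i); last first.
  by apply: smooth_congr IH => x _; rewrite big_cons (negbTE nPi).
by apply: smooth_congr (smoothM (Cf _ Pi) IH) => x _; rewrite big_cons Pi.
Qed.

Lemma smoothN (W : normedModType R) (f : V -> W) :
  smooth U f -> smooth U (fun x => - f x).
Proof. exact: (smooth_linear (L := -%R) opp_continuous). Qed.

Lemma smoothB (W : normedModType R) (f g : V -> W) :
  smooth U f -> smooth U g -> smooth U (fun x => f x - g x).
Proof. by move=> Cf Cg; apply: smoothD => //; exact: smoothN. Qed.

Lemma smooth_mulmx p q r (f : V -> 'M[R]_(p, q)) (g : V -> 'M[R]_(q, r)) :
  smooth U f -> smooth U g -> smooth U (fun x => f x *m g x).
Proof.
move=> /smooth_mxP Cf /smooth_mxP Cg; apply/smooth_mxP => i j.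
have C1 : smooth U (fun x => \sum_k f x i k * g x k j).
  by apply: smooth_sum => k _; apply: smoothM; [exact: Cf | exact: Cg].
by apply: smooth_congr C1 => x _; rewrite mxE.
Qed.

Lemma smooth_trmx p q (f : V -> 'M[R]_(p, q)) :
  smooth U f -> smooth U (fun x => (f x)^T).
Proof.
move=> /smooth_mxP Cf; apply/smooth_mxP => i j.
by apply: smooth_congr (Cf j i) => x _; rewrite mxE.
Qed.

Lemma smooth_det p (f : V -> 'M[R]_p) :
  smooth U f -> smooth U (fun x => \det (f x)).
Proof.
move=> /smooth_mxP Cf; rewrite /determinant.
apply: smooth_sum => s _; apply: smoothM; first exact: smooth_cst.
by apply: smooth_prod => i _; exact: Cf.
Qed.

(** Cramer's rule: each entry is a cofactor over the determinant. *)
Lemma smooth_invmx p (f : V -> 'M[R]_p) :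
  (forall x, U x -> f x \in unitmx) ->
  smooth U f -> smooth U (fun x => invmx (f x)).
Proof.
move=> uf Cf; apply/smooth_mxP => i j.
have C1 : smooth U (fun x => (\det (f x))^-1 * \adj (f x) i j).
  apply: smoothM.
    by apply: smoothV (smooth_det Cf) => x /uf; rewrite unitmxE unitfE.
  have C2 : smooth U (fun x => (-1) ^+ (j + i) * \det (row' j (col' i (f x)))).
    apply: smoothM; first exact: smooth_cst.
    apply: smooth_det; apply/smooth_mxP => k l.
    apply: smooth_congr ((smooth_mxP f).1 Cf (lift j k) (lift i l)) => x _.
    by rewrite !mxE.
  by apply: smooth_congr C2 => x _; rewrite mxE.
by apply: smooth_congr C1 => x Ux; rewrite /invmx (uf _ Ux) [RHS]mxE.
Qed.

Lemma smooth_comp n p q O (f : V -> 'rV[R]_n) (g : 'rV[R]_n -> 'M[R]_(p, q)) :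
  open O -> (forall x, U x -> O (f x)) ->
  smooth U f -> smooth O g -> smooth U (fun x => g (f x)).
Proof.
move=> oO UO Cf Cg; apply/smooth_mxP => i j m.
apply: (class_C_comp oU oO UO (Cf m) (g := fun y => g y i j)).
exact: class_C_coord.
Qed.

End Smooth.

(** * Symmetry of mixed second derivatives *)

Section Schwarz.
Context {R : realType} {V : normedModType R}.
Implicit Types (f : V -> R) (x v w : V).

Lemma is_derive_line f x v (t : R) : differentiable f (x + t *: v) ->
  is_derive t 1 (fun a : R => f (x + a *: v)) ('D_v f (x + t *: v)).
Proof.
move=> df; have dl : is_diff t (fun a : R => x + a *: v) ( *:%R ^~ v).
  have -> : (fun a : R => x + a *: v) = cst x + ( *:%R ^~ v) by [].
  by apply: is_diff_eq; rewrite add0r.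
have dc : differentiable (f \o (fun a : R => x + a *: v)) t.
  by apply: differentiable_comp.
apply: DeriveDef; first exact: diff_derivable.
rewrite [LHS](deriveE (1 : R) dc) diff_comp //= diff_val scale1r.
by rewrite -deriveE.
Qed.

(** Two mean value theorems: one along [v] for the increment [phi] of [f] in direction [w], one
    along [w] for the derivative of [f] along [v]. *)
Lemma second_difference f x v w (s : R) (U : set V) :
  0 < s -> smooth U f ->
  (forall a b, 0 <= a <= s -> 0 <= b <= s -> U (x + a *: v + b *: w)) ->
  exists a b, [/\ 0 <= a <= s, 0 <= b <= s &
    f (x + s *: v + s *: w) - f (x + s *: v) - (f (x + s *: w) - f x) =
    'D_w ('D_v f) (x + a *: v + b *: w) * s * s].
Proof.
move=> s0 Cf bU; have s00 : 0 <= s <= s by rewrite lexx ltW.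
have s01 : 0 <= (0 : R) <= s by rewrite lexx (ltW s0).
have df y : U y -> differentiable f y by exact: smooth_differentiable.
have dvf y : U y -> differentiable ('D_v f) y.
  by apply: smooth_differentiable; exact: smooth_derive.
pose phi a := f (x + s *: w + a *: v) - f (x + a *: v).
have dphi a : 0 <= a <= s -> is_derive a 1 phi
    ('D_v f (x + s *: w + a *: v) - 'D_v f (x + a *: v)).
  move=> a0; have U1 := bU _ _ a0 s00; have U2 := bU _ _ a0 s01.
  rewrite scale0r addr0 in U2; rewrite addrAC in U1.
  have := is_derive_line (df _ U1); have := is_derive_line (df _ U2).
  by move=> d2 d1; exact: is_deriveB.
have inb a : a \in `]0, s[ -> 0 <= a <= s.
  by rewrite in_itv /= => /andP[/ltW -> /ltW ->].
have mvt (h dh : R -> R) : (forall a, 0 <= a <= s -> is_derive a 1 h (dh a)) ->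
    exists2 a, 0 <= a <= s & h s - h 0 = dh a * s.
  move=> hdh; have [|a /inb ab E] := @MVT R h dh 0 s s0 (fun a ab => hdh a (inb a ab)).
    apply: derivable_within_continuous => a; rewrite in_itv /= => ab.
    by have [] := hdh a ab.
  by exists a => //; rewrite E subr0.
have [a ab Ea] := mvt _ _ dphi.
have dpsi b : 0 <= b <= s -> is_derive b 1 (fun b : R => 'D_v f (x + a *: v + b *: w))
    ('D_w ('D_v f) (x + a *: v + b *: w)).
  by move=> bb; apply: is_derive_line; apply: dvf; exact: bU.
have [b bb Eb] := mvt _ _ dpsi.
exists a, b; split=> //; rewrite -Eb scale0r addr0.
by move: Ea; rewrite /phi !scale0r !addr0 ![x + s *: w + _]addrAC.
Qed.

(** The second difference is symmetric in [v] and [w], so the two mixed derivatives take a common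
    value, each at some point of one small parallelogram. Continuity brings both points back to
    [x]. *)
Lemma derive_comm f x v w (U : set V) :
  open U -> smooth U f -> U x -> 'D_w ('D_v f) x = 'D_v ('D_w f) x.
Proof.
move=> oU Cf Ux; apply/eqP; rewrite -subr_eq0 -normr_le0; apply/ler_addgt0Pr => e e0.
rewrite add0r.
(* [A] and [B] are kept abstract: unifying one with the other diverges. *)
have [A EA] : exists A, A = 'D_w ('D_v f) := ex_intro _ _ erefl.
have [B EB] : exists B, B = 'D_v ('D_w f) := ex_intro _ _ erefl.
have cA : {for x, continuous A}.
  rewrite EA.
  exact: (smooth_continuous (smooth_derive w (smooth_derive v Cf)) Ux).
have cB : {for x, continuous B}.
  rewrite EB.
  exact: (smooth_continuous (smooth_derive v (smooth_derive w Cf)) Ux).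
have e20 : 0 < e / 2 by rewrite divr_gt0.
have nU : \forall y \near x, [/\ U y, `|A x - A y| < e / 2 & `|B x - B y| < e / 2].
  have nU : \forall y \near x, U y by apply: open_nbhs_nbhs.
  have nA := (cvgrPdist_lt _ _).1 cA _ e20; have nB := (cvgrPdist_lt _ _).1 cB _ e20.
  by apply: filterS3 nU (nA _) (nB _) => y uy ay by'; split.
have [r r0 rU] := (nbhs_normP _ _).1 nU.
(* A parallelogram of side parameter [s] stays within s(|v| + |w|) <= s K = r / 2 < r of [x]; the
   summand 1 keeps [K] positive when both vectors vanish. *)
pose K := 1 + `|v| + `|w|.
have K0 : 0 < K by rewrite /K -addrA ltr_wpDr // addr_ge0.
pose s := r / K / 2.
have s0 : 0 < s by rewrite !divr_gt0.
have bU a b : 0 <= a <= s -> 0 <= b <= s ->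
    [/\ U (x + a *: v + b *: w), `|A x - A (x + a *: v + b *: w)| < e / 2
      & `|B x - B (x + a *: v + b *: w)| < e / 2].
  move=> /andP[a0 aS] /andP[b0 bs]; apply: rU.
  rewrite /= -addrA opprD addrA subrr add0r normrN.
  apply: (le_lt_trans (ler_normD _ _)); rewrite !normrZ !ger0_norm //.
  apply: (@le_lt_trans _ _ (s * K)).
    rewrite /K -addrA mulrDr mulr1 mulrDr.
    by rewrite ler_wpDl ?(ltW s0) // lerD // ler_wpM2r.
  by rewrite /s mulrAC divfK ?gt_eqF // ltr_pdivrMr // ltr_pMr // ltr1n.
have [a1 [b1 [a1b b1b E1]]] := second_difference s0 Cf
  (fun a b ha hb => let: And3 u _ _ := bU a b ha hb in u).
have bU' b a : 0 <= b <= s -> 0 <= a <= s -> U (x + b *: w + a *: v).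
  by move=> hb ha; rewrite addrAC; have [] := bU a b ha hb.
have [b2 [a2 [b2b a2b E2]]] := second_difference s0 Cf bU'.
have [_ HA _] := bU _ _ a1b b1b; have [_ _ HB] := bU _ _ a2b b2b.
have EAB : A (x + a1 *: v + b1 *: w) = B (x + a2 *: v + b2 *: w).
  apply: (@mulIf _ s); rewrite ?gt_eqF //; apply: (@mulIf _ s); rewrite ?gt_eqF //.
  rewrite EA -E1 [x + a2 *: v + _]addrAC EB -E2 [x + s *: w + _]addrAC.
  by rewrite !opprB addrACA [RHS]addrACA; congr (_ + _); rewrite addrC.
have -> : 'D_w ('D_v f) x = A x by rewrite EA.
have -> : 'D_v ('D_w f) x = B x by rewrite EB.
have -> : A x - B x = (A x - A (x + a1 *: v + b1 *: w))
    - (B x - B (x + a2 *: v + b2 *: w)) by rewrite EAB opprB addrA subrK.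
apply: (le_trans (ler_normB _ _)).
by rewrite [leRHS]splitr lerD // ltW.
Qed.

End Schwarz.

(** * Christoffel symbols and curvature *)

Section MatrixDerivatives.
Context {R : realType} {V : normedModType R}.
Variables (x v : V).

Lemma differentiable_mulmx p q r (f : V -> 'M[R]_(p, q)) (g : V -> 'M[R]_(q, r)) :
  differentiable f x -> differentiable g x -> differentiable (fun y => f y *m g y) x.
Proof.
move=> /differentiable_mxP df /differentiable_mxP dg; apply/differentiable_mxP => i j.
have -> : (fun y => (f y *m g y) i j) =
    \sum_k ((fun y => f y i k) * (fun y => g y k j)).
  by apply/funext => y; rewrite mxE fct_sumE.
by apply: differentiable_sum => k; exact: differentiableM.
Qed.

Lemma derive_mulmx p q r (f : V -> 'M[R]_(p, q)) (g : V -> 'M[R]_(q, r)) :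
  differentiable f x -> differentiable g x ->
  'D_v (fun y => f y *m g y) x = 'D_v f x *m g x + f x *m 'D_v g x.
Proof.
move=> df dg; apply/matrixP => i j.
rewrite derive_mxE; last exact: differentiable_mulmx.
have -> : (fun y => (f y *m g y) i j) =
    \sum_k ((fun y => f y i k) * (fun y => g y k j)).
  by apply/funext => y; rewrite mxE fct_sumE.
have /differentiable_mxP df' := df; have /differentiable_mxP dg' := dg.
rewrite derive_sum; last by move=> k; apply: derivableM; exact: diff_derivable.
rewrite !mxE -big_split; apply: eq_bigr => k _ /=.
rewrite deriveM; [|exact: diff_derivable..].
by rewrite !derive_mxE // addrC; congr (_ + _); rewrite mulrC.
Qed.

Lemma differentiable_trmx p q (f : V -> 'M[R]_(p, q)) :
  differentiable f x -> differentiable (fun y => (f y)^T) x.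
Proof.
move=> /differentiable_mxP df; apply/differentiable_mxP => i j.
by under eq_fun do rewrite mxE; exact: df.
Qed.

Lemma derive_trmx p q (f : V -> 'M[R]_(p, q)) :
  differentiable f x -> 'D_v (fun y => (f y)^T) x = ('D_v f x)^T.
Proof.
move=> df; apply/matrixP => i j; rewrite [RHS]mxE !derive_mxE //.
  by congr ('D_v _ x); apply/funext => y; rewrite mxE.
exact: differentiable_trmx.
Qed.

End MatrixDerivatives.

Section MatrixEntries.
Context {R : ringType} {p q : nat}.
Implicit Types A B : 'M[R]_(p, q).

Lemma addmxE A B i j : (A + B) i j = A i j + B i j. Proof. by rewrite mxE. Qed.
Lemma oppmxE A i j : (- A) i j = - A i j. Proof. by rewrite mxE. Qed.
Lemma scalemxE a A i j : (a *: A) i j = a * A i j. Proof. by rewrite mxE. Qed.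
Lemma trmxE A i j : A^T j i = A i j. Proof. by rewrite mxE. Qed.

Lemma zeromxE i j : (0 : 'M[R]_(p, q)) i j = 0. Proof. by rewrite mxE. Qed.
Lemma trmxD A B : (A + B)^T = A^T + B^T. Proof. exact: linearD. Qed.
Lemma trmxN A : (- A)^T = - A^T. Proof. exact: linearN. Qed.
Lemma trmxZ a A : (a *: A)^T = a *: A^T. Proof. exact: linearZ. Qed.

Definition zmxE := (addmxE, oppmxE, scalemxE, zeromxE).
End MatrixEntries.

Definition dist_mxE {R : comRingType} := (@mulmxDl R, @mulmxDr R, @mulNmx R, @mulmxN R,
  @scalemxAl R, @scalemxAr R, @trmx_mul R, @trmxK R, @trmxD R, @trmxN R, @trmxZ R, @mulmxA R).

Section Koszul.
Context {R : realType} {n : nat}.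
Implicit Types (g J : 'M[R]_n) (d G : 'I_n -> 'M[R]_n).

(* The Christoffel symbols of the first kind, [d a] being the derivative of the
   metric along the a-th coordinate. *)
Definition koszul d (a : 'I_n) : 'M[R]_n :=
  \matrix_(b, l) (2^-1 * (d a b l + d b a l - d l a b)).

Definition torsion_free G := forall a b h, G a b h = G b a h.

Lemma koszul_torsion_free d : (forall a, (d a)^T = d a) ->
  torsion_free (koszul d).
Proof.
move=> ds a b l; rewrite !mxE; congr (_ * _).
by rewrite -[d l b a]trmxE ds; ring.
Qed.

Lemma koszul_metric d a : (forall a, (d a)^T = d a) ->
  koszul d a + (koszul d a)^T = d a.
Proof.
move=> ds; apply/matrixP => b l; rewrite !mxE.
by rewrite -[d a l b]trmxE ds; field.
Qed.

(** Uniqueness of the Levi-Civita connection: by [W], which is torsion-freeness with the last index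
    lowered, the Koszul combination of the three derivatives collapses to twice one term. It serves
    to derive the transformation law of the Christoffel symbols. *)
Lemma koszul_unique d g G : torsion_free G ->
  (forall a, d a = G a *m g + (G a *m g)^T) -> forall a, G a *m g = koszul d a.
Proof.
move=> tf dE a; apply/matrixP => b l; rewrite [RHS]mxE !dE !addmxE !trmxE.
have W i j k : (G i *m g) j k = (G j *m g) i k.
  by rewrite !mxE; apply: eq_bigr => h _; rewrite tf.
by rewrite (W b a l) (W l a b) (W l b a); field.
Qed.

(** The connection matrix in the row-vector convention: the covariant derivative of [Y] along the
    a-th coordinate is its plain derivative plus [Y] times this matrix. *)
Definition christoffel_mx (g : 'rV[R]_n -> 'M[R]_n) y (a : 'I_n) : 'M[R]_n :=
  \matrix_(b, h) christoffel g y h a b.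

Definition pd (W : normedModType R) (f : 'rV[R]_n -> W) (y : 'rV[R]_n) (a : 'I_n) :=
  'D_(delta_mx 0 a) f y.

Lemma christoffel_mx_koszul (g : 'rV[R]_n -> 'M[R]_n) y a :
  differentiable g y -> g y \in unitmx -> (g y)^T = g y ->
  christoffel_mx g y a *m g y = koszul (pd g y) a.
Proof.
move=> dg ug sg.
have -> : christoffel_mx g y a = koszul (pd g y) a *m invmx (g y).
  apply/matrixP => b h; rewrite mxE /christoffel mxE mulr_sumr.
  apply: eq_bigr => l _; rewrite mxE -[invmx _ h l]trmxE trmx_inv sg.
  by rewrite /pd !derive_mxE //; ring.
by rewrite mulmxKV.
Qed.

(** Cancel [g] on the right. Purity turns [G *m J *m g] into [G *m g *m J^T], so that [G] survives
    only in the lowered form [L]. *)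
Lemma koszul_pure (J dJ g L G : 'M[R]_n) :
  g \in unitmx -> J *m g = g *m J^T -> G *m g = L ->
  (dJ + J *m G - G *m J = 0) <-> (dJ *m g + J *m L = L *m J^T).
Proof.
move=> ug pg <-; have E : (dJ + J *m G - G *m J) *m g =
    dJ *m g + J *m (G *m g) - G *m g *m J^T.
  by rewrite mulmxBl mulmxDl !mulmxA -[G *m J *m g]mulmxA pg mulmxA.
split=> [H|H].
  by apply/eqP; rewrite -subr_eq0 -E H mul0mx.
by apply: (can_inj (mulmxK ug)); rewrite mul0mx E H subrr.
Qed.

End Koszul.

(** * Symmetries of the curvature tensor, pointwise *)

Section Curvature.
Context {R : realType} {n : nat}.
Variables (g J : 'M[R]_n) (G : 'I_n -> 'M[R]_n) (dG : 'I_n -> 'I_n -> 'M[R]_n).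

(* [dG b l] stands for the derivative of [G l] along the b-th coordinate. *)
Definition curvature b l := dG b l - dG l b + G l *m G b - G b *m G l.

Hypothesis sg : g^T = g.
Hypothesis ug : g \in unitmx.
Hypothesis pg : J *m g = g *m J^T.
Hypothesis tf : torsion_free G.
Hypothesis dtf : forall b, torsion_free (dG b).
(** [d l] is the derivative of a parallel metric and [H l b] that of [G l *m g] along the b-th
    coordinate, so [dd] is the commutation of the second derivatives of the metric. Likewise [dJ] is
    the derivative of a parallel J and [ddJ] the commutation of its second derivatives. *)
Let d b := G b *m g + (G b *m g)^T.
Let H l b := dG b l *m g + G l *m d b.
Hypothesis dd : forall b l, H l b + (H l b)^T = H b l + (H b l)^T.
Let dJ b := G b *m J - J *m G b.
Hypothesis ddJ : forall b l,
  dG b l *m J + G l *m dJ b - (dJ b *m G l + J *m dG b l) =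
  dG l b *m J + G b *m dJ l - (dJ l *m G b + J *m dG l b).

Lemma curvatureN b l : curvature b l = - curvature l b.
Proof. by apply/matrixP => a h; rewrite /curvature !zmxE; ring. Qed.

Lemma bianchi b l a h :
  curvature b l a h + curvature l a b h + curvature a b l h = 0.
Proof.
rewrite /curvature !zmxE (dtf b a l) (dtf l b a) (dtf a l b).
have E i j k : (G i *m G j) k h = (G k *m G j) i h.
  by rewrite !mxE; apply: eq_bigr => m _; rewrite tf.
by rewrite (E a l b) (E b a l) (E l b a); ring.
Qed.

(** The Ricci identity for the parallel tensor [g]: in [dd] the terms [G l *m g *m (G b)^T] and
    their transposes cancel, and the rest is curvature. [curvatureJ] is the same identity for J. *)
Lemma curvature_skew b l : curvature b l *m g + (curvature b l *m g)^T = 0.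
Proof.
have := dd b l; rewrite /H /d /curvature !dist_mxE !sg.
move=> /matrixP E; apply/matrixP => i j; have := E i j.
by rewrite !zmxE => {}E; lra.
Qed.

Lemma curvatureJ b l : curvature b l *m J = J *m curvature b l.
Proof.
have := ddJ b l; rewrite /dJ /curvature !dist_mxE.
move=> /matrixP E; apply/matrixP => i j; have := E i j.
by rewrite !zmxE => {}E; lra.
Qed.

Lemma curvature_pair b l a h :
  (curvature b l *m g) a h = (curvature a h *m g) b l.
Proof.
have skew x y z w : (curvature x y *m g) z w = - (curvature x y *m g) w z.
  have /matrixP/(_ z w) := curvature_skew x y.
  by rewrite addmxE trmxE zeromxE => E; lra.
have anti x y z w : (curvature x y *m g) z w = - (curvature y x *m g) z w.
  by rewrite curvatureN mulNmx oppmxE.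
have cyc x y z w : (curvature x y *m g) z w + (curvature y z *m g) x w
    + (curvature z x *m g) y w = 0.
  rewrite !mxE -!big_split big1 // => k _ /=.
  by rewrite -!mulrDl bianchi mul0r.
(* Four Bianchi identities, each of the four indices being once in the last place. Skewness in both
   index pairs brings their terms to common representatives, and the claim is a linear
   combination. *)
have := cyc b l a h; have := cyc l a h b; have := cyc a h b l; have := cyc h b l a.
rewrite (skew l a h b) (skew a h l b) (anti h l a b) (anti h b a l) (skew b h a l).
rewrite (anti b a h l) (skew a b h l) (anti h b l a) (skew b l h a) (skew l h b a).
lra.
Qed.

(** Pair symmetry exchanges the roles of the index pairs: [b] and [l] become the matrix indices of
    lowered curvature endomorphisms, for which purity follows from [curvatureJ] and the purity of
    [g]. The inverse of [g] raises the index [h] again. *)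
Lemma curvature_pure a h :
  J *m (\matrix_(b, l) curvature b l a h) = (\matrix_(b, l) curvature b l a h) *m J^T.
Proof.
have -> : (\matrix_(b, l) curvature b l a h) =
    \sum_k invmx g k h *: (curvature a k *m g).
  apply/matrixP => b l; rewrite mxE summxE.
  transitivity ((curvature b l *m g *m invmx g) a h); first by rewrite mulmxK.
  by rewrite [LHS]mxE; apply: eq_bigr => k _; rewrite scalemxE curvature_pair mulrC.
rewrite mulmx_sumr mulmx_suml; apply: eq_bigr => k _.
rewrite -scalemxAr -scalemxAl; congr (_ *: _).
by rewrite mulmxA -curvatureJ -!mulmxA pg.
Qed.

End Curvature.

(** * The modified Riemannian extension in an adapted frame *)

Section RiemannExtensionAlgebra.
Context {R : realType} {n : nat}.
Variables (J c N : 'M[R]_n) (p : 'rV[R]_n).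
Variables (G A dc dN : 'I_n -> 'M[R]_n) (dG : 'I_n -> 'I_n -> 'M[R]_n).

Hypothesis tf : torsion_free G.
Hypothesis dtf : forall b, torsion_free (dG b).
Hypothesis NE : forall b l, N b l = \sum_h p 0 h * G l b h.
Hypothesis dNE : forall a b l, dN a b l = \sum_h p 0 h * dG a l b h.
Hypothesis AE : forall a, A a = G a *m J - J *m G a.
Hypothesis curvJ : forall a h,
  J *m (\matrix_(b, l) curvature G dG b l a h) =
  (\matrix_(b, l) curvature G dG b l a h) *m J^T.

(** With [N] symmetric this is the classical coordinate form, whose base block is c_ij - 2 p_h
    Gamma^h_ij. Passing from the adapted frame to the coordinate frame produces [N] once on each
    side. *)
Definition riem_ext_block : 'M[R]_(n + n) :=
  block_mx (c - N - N^T) 1%:M 1%:M 0.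
Definition hlift_block : 'M[R]_(n + n) :=
  block_mx J (J *m N - N *m J^T) 0 J^T.

(* The derivative of [N] along the fibre coordinate [p_a]. *)
Definition vmx (a : 'I_n) : 'M[R]_n := \matrix_(b, l) G l b a.

(* The derivatives of [riem_ext_block] and [hlift_block] along the base ([inl])
   and the fibre ([inr]) coordinates, when [A], [dc], [dN] are those of [J], [c],
   [N] along the base coordinates. *)
Definition d_riem_ext (k : 'I_(n + n)) : 'M[R]_(n + n) :=
  match fintype.split k with
  | inl a => block_mx (dc a - dN a - (dN a)^T) 0 0 0
  | inr a => block_mx (- vmx a - (vmx a)^T) 0 0 0
  end.

Definition d_hlift (k : 'I_(n + n)) : 'M[R]_(n + n) :=
  match fintype.split k with
  | inl a => block_mx (A a) (A a *m N + J *m dN a - (dN a *m J^T + N *m (A a)^T))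
                      0 (A a)^T
  | inr a => block_mx 0 (J *m vmx a - vmx a *m J^T) 0 0
  end.

Let NT : N^T = N.
Proof. by apply/matrixP => b l; rewrite mxE !NE; apply: eq_bigr => h _; rewrite tf. Qed.

Let dNT a : (dN a)^T = dN a.
Proof. by apply/matrixP => b l; rewrite mxE !dNE; apply: eq_bigr => h _; rewrite dtf. Qed.

Let vmxT a : (vmx a)^T = vmx a.
Proof. by apply/matrixP => b l; rewrite !mxE tf. Qed.

Let d_riem_extl b :
  d_riem_ext (lshift n b) = block_mx (dc b - dN b - (dN b)^T) 0 0 0.
Proof. by rewrite /d_riem_ext; have := unsplitK (inl b : 'I_n + 'I_n) => /= ->. Qed.

Let d_riem_extr b :
  d_riem_ext (rshift n b) = block_mx (- vmx b - (vmx b)^T) 0 0 0.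
Proof. by rewrite /d_riem_ext; have := unsplitK (inr b : 'I_n + 'I_n) => /= ->. Qed.

(** The metric depends on the fibre coordinates only through [N], linearly with coefficients [G];
    this is why the off-diagonal blocks are [G a] and its negative transpose. *)
Lemma koszul_riem_ext_h a : koszul d_riem_ext (lshift n a) =
  block_mx (koszul dc a - 2 *: koszul dN a) (G a) (- (G a)^T) 0.
Proof.
apply/matrixP => i j.
case: (splitP i) => i' Ei; [have {Ei}-> : i = lshift n i' by exact: val_inj |
  have {Ei}-> : i = rshift n i' by exact: val_inj];
(case: (splitP j) => j' Ej; [have {Ej}-> : j = lshift n j' by exact: val_inj |
  have {Ej}-> : j = rshift n j' by exact: val_inj]); rewrite mxE !(d_riem_extl, d_riem_extr).
- by rewrite !block_mxEul !dNT !zmxE !mxE; field.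
- by rewrite !block_mxEul !block_mxEur !vmxT !zmxE !mxE tf; field.
- by rewrite !block_mxEdl block_mxEul block_mxEur !vmxT !zmxE !mxE (tf j'); field.
- by rewrite !block_mxEur !block_mxEdr !mxE; field.
Qed.

Lemma koszul_riem_ext_v a : koszul d_riem_ext (rshift n a) =
  block_mx (- vmx a) 0 0 0.
Proof.
apply/matrixP => i j.
case: (splitP i) => i' Ei; [have {Ei}-> : i = lshift n i' by exact: val_inj |
  have {Ei}-> : i = rshift n i' by exact: val_inj];
(case: (splitP j) => j' Ej; [have {Ej}-> : j = lshift n j' by exact: val_inj |
  have {Ej}-> : j = rshift n j' by exact: val_inj]); rewrite mxE !(d_riem_extl, d_riem_extr).
- by rewrite !block_mxEul !block_mxEdl !vmxT !zmxE; field.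
- by rewrite !block_mxEur !block_mxEdr !block_mxEdl !mxE; field.
- by rewrite !block_mxEdl !block_mxEdr !mxE; field.
- by rewrite !block_mxEdr !mxE; field.
Qed.

(** Puts the curvature contracted with the covector [p] into the shape in which it occurs in
    [hlift_parallel_h], that is, in terms of [N] and its base derivatives. *)
Lemma curvature_lowered a : \sum_h p 0 h *: (\matrix_(b, l) curvature G dG b l a h) =
  \matrix_(b, l) (dN b a l - dN l a b) + N *m (G a)^T - G a *m N.
Proof.
apply/matrixP => b l; rewrite summxE !zmxE.
have -> : (N *m (G a)^T) b l = \sum_h p 0 h * (G l *m G b) a h.
  rewrite mxE; under eq_bigr => m _ do rewrite NE mulr_suml.
  rewrite exchange_big; apply: eq_bigr => h _; rewrite mxE mulr_sumr.
  by apply: eq_bigr => m _; rewrite mxE (tf a l m) (tf m b h); ring.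
have -> : (G a *m N) b l = \sum_h p 0 h * (G b *m G l) a h.
  rewrite mxE; under eq_bigr => m _ do rewrite NE mulr_sumr.
  rewrite exchange_big; apply: eq_bigr => h _; rewrite mxE mulr_sumr.
  by apply: eq_bigr => m _; rewrite (tf a b m); ring.
rewrite mxE !dNE -!sumrB -!big_split -sumrB /=; apply: eq_bigr => h _.
by rewrite /curvature !zmxE mxE !zmxE; ring.
Qed.

Lemma hlift_parallel_h a :
  (d_hlift (lshift n a) *m riem_ext_block
     + hlift_block *m koszul d_riem_ext (lshift n a) =
   koszul d_riem_ext (lshift n a) *m hlift_block^T)
  <-> (A a *m c + J *m koszul dc a = koszul dc a *m J^T).
Proof.
have -> : d_hlift (lshift n a) =
    block_mx (A a) (A a *m N + J *m dN a - (dN a *m J^T + N *m (A a)^T)) 0 (A a)^T.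
  by rewrite /d_hlift; have := unsplitK (inl a : 'I_n + 'I_n) => /= ->.
rewrite koszul_riem_ext_h /riem_ext_block /hlift_block tr_block_mx.
rewrite !mulmx_block add_block_mx !(mulmx0, mul0mx, mulmx1, addr0, add0r, trmx0).
(* [S] collects the two derivatives in [2 *: koszul dN a] that are not along [a]; the remaining
   [dN a] will cancel against the derivative of the horizontal lift. *)
pose S := \matrix_(b, l) (dN b a l - dN l a b).
have SE : 2 *: koszul dN a = dN a + S.
  by apply/matrixP => b l; rewrite !mxE -[dN b a l]trmxE dNT; field.
have curv : J *m (S + N *m (G a)^T - G a *m N) = (S + N *m (G a)^T - G a *m N) *m J^T.
  rewrite -curvature_lowered mulmx_sumr mulmx_suml; apply: eq_bigr => h _.
  by rewrite -scalemxAr -scalemxAl curvJ.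
rewrite SE NT.
(* The horizontal-horizontal block. After replacing [A a] by [G a *m J - J *m G a], its terms in [N]
   and [dN] add up to the difference of the two sides of [curv]. *)
have K1 : A a *m (c - N - N) +
  (A a *m N + J *m dN a - (dN a *m J^T + N *m (A a)^T)) +
  (J *m (koszul dc a - (dN a + S)) + (J *m N - N *m J^T) *m - (G a)^T)
  - ((koszul dc a - (dN a + S)) *m J^T + G a *m (J *m N - N *m J^T)^T) =
  A a *m c + J *m koszul dc a - koszul dc a *m J^T.
  have := curv; rewrite AE !dist_mxE NT => /matrixP E.
  apply/matrixP => b l; have := E b l; rewrite !zmxE => {}E.
  lra.
split=> [/eq_block_mx[E _ _ _]|E].
  by apply/eqP; rewrite -subr_eq0 -K1 E subrr.
congr block_mx.
- by apply/eqP; rewrite -subr_eq0 K1 E subrr.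
- by rewrite AE trmxK subrK.
- by rewrite AE !dist_mxE addrAC subrr add0r.
Qed.

Lemma hlift_parallel_v a :
  d_hlift (rshift n a) *m riem_ext_block
     + hlift_block *m koszul d_riem_ext (rshift n a) =
   koszul d_riem_ext (rshift n a) *m hlift_block^T.
Proof.
have -> : d_hlift (rshift n a) = block_mx 0 (J *m vmx a - vmx a *m J^T) 0 0.
  by rewrite /d_hlift; have := unsplitK (inr a : 'I_n + 'I_n) => /= ->.
rewrite koszul_riem_ext_v /riem_ext_block /hlift_block tr_block_mx.
rewrite !mulmx_block add_block_mx !(mulmx0, mul0mx, mulmx1, addr0, add0r, trmx0).
by rewrite mulmxN mulNmx addrAC subrr add0r.
Qed.

End RiemannExtensionAlgebra.

(** * The Tachibana operator in coordinates *)

Section TachibanaAlgebra.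
Context {R : realType} {n : nat}.
Variables (J t : 'M[R]_n) (dJ dt : 'I_n -> 'M[R]_n).

(* The components of the Tachibana operator on coordinate vector fields. *)
Definition tachibana_coef (k i j : 'I_n) : R :=
  \sum_m J k m * dt m i j - (dJ k *m t + J *m dt k) i j
  + (dJ i *m t) k j + (dJ j *m t) k i.

Hypothesis ts : t^T = t.
Hypothesis dts : forall a, (dt a)^T = dt a.
Hypothesis dpure : forall a, dJ a *m t + J *m dt a = dt a *m J^T + t *m (dJ a)^T.

(** The bracket is the derivative of [J *m t], which is symmetric because [t] is symmetric and pure;
    the last two terms trade places. *)
Lemma tachibana_coefC k i j : tachibana_coef k i j = tachibana_coef k j i.
Proof.
rewrite /tachibana_coef -!addrA [X in _ + (_ + X)]addrC; congr (_ + _); [|congr (_ + _)].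
- by apply: eq_bigr => m _; rewrite -[dt m i j]trmxE dts.
- rewrite {1}dpure -[in LHS](trmxK (dt k *m _ + _)) mxE.
  by rewrite !dist_mxE ts dts addrC.
Qed.

(** By [dpure] the derivative of [t] along [a] contributes only [dJ a *m t], symmetrised. By [E2]
    the terms in [dJ b] and [dJ l] cancel between the two coefficients on the right. *)
Lemma koszul_tachibana a b l :
  2 * (dJ a *m t + J *m koszul dt a - koszul dt a *m J^T) b l =
  tachibana_coef b a l + tachibana_coef l a b.
Proof.
have E1 : (dJ a *m t + J *m dt a) b l = (dt a *m J^T + t *m (dJ a)^T) b l by rewrite dpure.
have tdJ i j k : (t *m (dJ k)^T) i j = (dJ k *m t) j i.
  by rewrite -[RHS]trmxE trmx_mul ts.
have JK : (J *m koszul dt a) b l = 2^-1 * ((J *m dt a) b l +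
    \sum_m J b m * dt m a l - (J *m dt l) b a).
  rewrite !mxE -big_split -sumrB mulr_sumr /=; apply: eq_bigr => m _.
  by rewrite mxE -[dt l m a]trmxE dts; ring.
have KJ : (koszul dt a *m J^T) b l = 2^-1 * ((dt a *m J^T) b l +
    (J *m dt b) l a - \sum_m J l m * dt m a b).
  rewrite !mxE -big_split -sumrB mulr_sumr /=; apply: eq_bigr => m _.
  by rewrite !mxE -[dt b m a]trmxE dts; ring.
have E2 k i j : (dJ k *m t + J *m dt k) i j = (dJ k *m t + J *m dt k) j i.
  by rewrite {1}dpure -[RHS]trmxE !dist_mxE ts dts addrC.
move: E1; rewrite /tachibana_coef (E2 b) (E2 l) !zmxE JK KJ !tdJ => E1.
lra.
Qed.

Lemma koszul_tachibana_iff :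
  (forall a, dJ a *m t + J *m koszul dt a = koszul dt a *m J^T) <->
  (forall k i j, tachibana_coef k i j = 0).
Proof.
split=> [H|H a].
  have anti b a l : tachibana_coef b a l = - tachibana_coef l a b.
    have := koszul_tachibana a b l; rewrite H subrr mxE => E; lra.
  move=> k i j.
  (* Exchanging the outer indices changes the sign, exchanging the last two does not. Alternating
     them three times restores the order of the indices with total sign -1. *)
  have := anti k i j; have := anti j k i; have := anti i j k.
  rewrite (tachibana_coefC j k i) (tachibana_coefC i j k) (tachibana_coefC k j i).
  by move=> *; lra.
apply/eqP; rewrite -subr_eq0; apply/eqP/matrixP => b l; rewrite [RHS]mxE.
by have := koszul_tachibana a b l; rewrite !H => E; lra.
Qed.

End TachibanaAlgebra.

(** * Coordinate formulas for nabla J and for the Tachibana operator *)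

Section LocalFormulas.
Context {R : realType} {n : nat}.
Implicit Types (g J t : 'rV[R]_n -> 'M[R]_n) (X Y Z : 'rV[R]_n -> 'rV[R]_n).

Lemma bilE (B : 'M[R]_n) v w : bil B v w = \sum_i \sum_j v 0 i * w 0 j * B i j.
Proof.
rewrite /bil mxE exchange_big; apply: eq_bigr => j _; rewrite !mxE mulr_suml.
by apply: eq_bigr => i _; ring.
Qed.

Lemma bil_delta (B : 'M[R]_n) i j : bil B (delta_mx 0 i) (delta_mx 0 j) = B i j.
Proof. by rewrite /bil -rowE trmx_delta -colE !mxE. Qed.

Lemma derive_pd (W : normedModType R) (f : 'rV[R]_n -> W) v y :
  differentiable f y -> 'D_v f y = \sum_a v 0 a *: pd f y a.
Proof. exact: derive_rowE. Qed.

Lemma levi_civita_mx g X Y y : levi_civita g X Y y =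
  'D_(X y) Y y + Y y *m \sum_a X y 0 a *: christoffel_mx g y a.
Proof.
congr (_ + _); apply/rowP => h; rewrite !mxE exchange_big; apply: eq_bigr => b _ /=.
rewrite summxE mulr_sumr; apply: eq_bigr => a _.
by rewrite !mxE; ring.
Qed.

Lemma derive_act J Y v y : differentiable J y -> differentiable Y y ->
  'D_v (act J Y) y = 'D_v Y y *m J y + Y y *m 'D_v J y.
Proof. by move=> dJ dY; rewrite [LHS]derive_mulmx. Qed.

(** Tensoriality: the derivatives of [Y] cancel, so parallelism of J becomes a matrix identity at
    each point. *)
Lemma nabla_J g J X Y y : differentiable J y -> differentiable Y y ->
  levi_civita g X (act J Y) y - act J (levi_civita g X Y) y =
  Y y *m \sum_a X y 0 a *: (pd J y a + J y *m christoffel_mx g y a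
                            - christoffel_mx g y a *m J y).
Proof.
move=> dJ dY; rewrite [X in _ - X]/act !levi_civita_mx derive_act // /act.
rewrite (derive_pd _ dJ).
have -> : \sum_a X y 0 a *: (pd J y a + J y *m christoffel_mx g y a
      - christoffel_mx g y a *m J y) = \sum_a X y 0 a *: pd J y a +
   J y *m (\sum_a X y 0 a *: christoffel_mx g y a)
   - (\sum_a X y 0 a *: christoffel_mx g y a) *m J y.
  rewrite mulmx_sumr mulmx_suml -big_split -sumrB /=; apply: eq_bigr => a _.
  by rewrite scalerBr scalerDr -scalemxAr -scalemxAl.
rewrite mulmxBr mulmxDr mulmxDl !mulmxA.
by apply/matrixP => i j; rewrite !zmxE; ring.
Qed.

Lemma parallelP g J y : differentiable J y ->
  (forall a, pd J y a + J y *m christoffel_mx g y a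
     - christoffel_mx g y a *m J y = 0) <->
  (forall a b, levi_civita g (cst (delta_mx 0 a)) (act J (cst (delta_mx 0 b))) y =
     act J (levi_civita g (cst (delta_mx 0 a)) (cst (delta_mx 0 b))) y).
Proof.
move=> dJ; split=> [H a b|H a].
  apply/eqP; rewrite -subr_eq0 nabla_J // big1 ?mulmx0 // => k _.
  by rewrite H scaler0.
apply/row_matrixP => b; rewrite row0 rowE.
have := H a b => /eqP; rewrite -subr_eq0 nabla_J // (bigD1 a) //= big1.
  by rewrite mxE !eqxx scale1r addr0 => /eqP.
by move=> k ka; rewrite mxE (negbTE ka) andbF scale0r.
Qed.

Lemma derive_bilf t Y Z v y : differentiable t y -> differentiable Y y ->
  differentiable Z y -> 'D_v (bilf t Y Z) y =
  ('D_v Y y *m t y *m (Z y)^T + Y y *m 'D_v t y *m (Z y)^T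
   + Y y *m t y *m ('D_v Z y)^T) 0 0.
Proof.
move=> dt dY dZ.
have dYt : differentiable (fun z => Y z *m t z) y by exact: differentiable_mulmx.
have dZT : differentiable (fun z => (Z z)^T) y by exact: differentiable_trmx.
rewrite -mulmxDl -derive_mulmx // -derive_trmx // -derive_mulmx //.
by rewrite [RHS]derive_mxE //; exact: differentiable_mulmx.
Qed.

(** Tensoriality of the Tachibana operator, with derivatives as free variables: [dXY] stands for the
    derivative of [Y] along [X], [dJXY] for that along [X *m J], [JX] and [tX] for the derivatives
    of [J] and [t] along [X], [tJX] for that of [t] along [X *m J]. Purity and symmetry of [t]
    remove every derivative of a vector field. *)
Lemma tachibana_algebra (J t : 'M[R]_n) (X Y Z dXY dXZ dYX dZX dJXY dJXZ : 'rV[R]_n)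
    (tJX tX JX JY JZ : 'M[R]_n) : t^T = t -> J *m t = t *m J^T ->
  (dJXY *m t *m Z^T + Y *m tJX *m Z^T + Y *m t *m dJXZ^T) 0 0
  - ((dXY *m J + Y *m JX) *m t *m Z^T + Y *m J *m tX *m Z^T + Y *m J *m t *m dXZ^T) 0 0
  + bil t (dYX *m J + X *m JY - dJXY - (dYX - dXY) *m J) Z
  + bil t Y (dZX *m J + X *m JZ - dJXZ - (dZX - dXZ) *m J) =
  bil tJX Y Z - bil (JX *m t + J *m tX) Y Z + bil (JY *m t) X Z + bil (JZ *m t) X Y.
Proof.
move=> ts tp; have bilC : bil (JZ *m t) X Y = (Y *m t *m (X *m JZ)^T) 0 0.
  by rewrite /bil -[RHS]trmxE !dist_mxE ts.
rewrite bilC /bil !dist_mxE -[Y *m J *m t]mulmxA tp !mulmxA !zmxE.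
ring.
Qed.

Lemma tachibana_mx J t X Y Z y :
  differentiable J y -> differentiable t y ->
  differentiable X y -> differentiable Y y -> differentiable Z y ->
  (t y)^T = t y -> J y *m t y = t y *m (J y)^T ->
  tachibana J t X Y Z y =
  bil ('D_(X y *m J y) t y) (Y y) (Z y)
  - bil ('D_(X y) J y *m t y + J y *m 'D_(X y) t y) (Y y) (Z y)
  + bil ('D_(Y y) J y *m t y) (X y) (Z y)
  + bil ('D_(Z y) J y *m t y) (X y) (Y y).
Proof.
move=> dJ dt dX dY dZ ts tp.
have dJY : differentiable (act J Y) y by exact: differentiable_mulmx.
have E1 := derive_bilf (X y *m J y) dt dY dZ.
have E2 := derive_bilf (X y) dt dJY dZ; rewrite (derive_act _ dJ dY) in E2.
have L W : lieJ W J X y = 'D_(W y) X y *m J y + X y *m 'D_(W y) J y - 'D_(X y *m J y) W y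
    - ('D_(W y) X y - 'D_(X y) W y) *m J y.
  by rewrite /lieJ /bracket (derive_act _ dJ dX).
apply: etrans _ (tachibana_algebra _ _ _ ('D_(X y) Y y) ('D_(X y) Z y) ('D_(Y y) X y)
  ('D_(Z y) X y) ('D_(X y *m J y) Y y) ('D_(X y *m J y) Z y) _ _ _ _ _ ts tp).
have LY := congr1 (fun u => bil (t y) u (Z y)) (L Y).
have LZ := congr1 (fun u => bil (t y) (Y y) u) (L Z).
exact: (congr2 +%R (congr2 +%R (congr2 (fun a b => a - b) E1 E2) LY) LZ).
Qed.

Lemma bil_sum (I : finType) (a : I -> R) (B : I -> 'M[R]_n) v w :
  bil (\sum_i a i *: B i) v w = \sum_i a i * bil (B i) v w.
Proof.
rewrite /bil mulmx_sumr mulmx_suml summxE; apply: eq_bigr => i _.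
by rewrite -scalemxAr -scalemxAl mxE.
Qed.

Lemma tachibana_coefE J t X Y Z y :
  differentiable J y -> differentiable t y ->
  differentiable X y -> differentiable Y y -> differentiable Z y ->
  (t y)^T = t y -> J y *m t y = t y *m (J y)^T ->
  tachibana J t X Y Z y = \sum_k \sum_i \sum_j X y 0 k * Y y 0 i * Z y 0 j *
    tachibana_coef (J y) (t y) (pd J y) (pd t y) k i j.
Proof.
move=> dJ dt dX dY dZ ts tp; rewrite tachibana_mx //.
have E1 : bil ('D_(X y *m J y) t y) (Y y) (Z y) = \sum_k \sum_i \sum_j
    X y 0 k * Y y 0 i * Z y 0 j * \sum_m J y k m * pd t y m i j.
  rewrite (derive_pd _ dt) bil_sum.
  under eq_bigr => m _ do rewrite mxE mulr_suml.
  rewrite exchange_big; apply: eq_bigr => k _ /=.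
  under eq_bigr => m _ do rewrite bilE mulr_sumr.
  rewrite exchange_big; apply: eq_bigr => i _ /=.
  under eq_bigr => m _ do rewrite mulr_sumr.
  rewrite exchange_big; apply: eq_bigr => j _ /=.
  by rewrite mulr_sumr; apply: eq_bigr => m _; ring.
have E2 : bil ('D_(X y) J y *m t y + J y *m 'D_(X y) t y) (Y y) (Z y) =
    \sum_k \sum_i \sum_j
    X y 0 k * Y y 0 i * Z y 0 j * (pd J y k *m t y + J y *m pd t y k) i j.
  rewrite (derive_pd _ dJ) (derive_pd _ dt) mulmx_suml mulmx_sumr -big_split /=.
  under eq_bigr => k _ do rewrite -scalemxAr -scalemxAl -scalerDr.
  rewrite bil_sum; apply: eq_bigr => k _; rewrite bilE mulr_sumr.
  apply: eq_bigr => i _; rewrite mulr_sumr; apply: eq_bigr => j _; ring.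
have E3 : bil ('D_(Y y) J y *m t y) (X y) (Z y) = \sum_k \sum_i \sum_j
    X y 0 k * Y y 0 i * Z y 0 j * (pd J y i *m t y) k j.
  rewrite (derive_pd _ dJ) mulmx_suml; under eq_bigr => k _ do rewrite -scalemxAl.
  rewrite bil_sum [RHS]exchange_big; apply: eq_bigr => i _; rewrite bilE mulr_sumr.
  apply: eq_bigr => k _; rewrite mulr_sumr; apply: eq_bigr => j _; ring.
have E4 : bil ('D_(Z y) J y *m t y) (X y) (Y y) = \sum_k \sum_i \sum_j
    X y 0 k * Y y 0 i * Z y 0 j * (pd J y j *m t y) k i.
  rewrite (derive_pd _ dJ) mulmx_suml; under eq_bigr => k _ do rewrite -scalemxAl.
  rewrite bil_sum; under eq_bigr => j _ do rewrite bilE mulr_sumr.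
  rewrite exchange_big; apply: eq_bigr => k _ /=.
  under eq_bigr => m _ do rewrite mulr_sumr.
  rewrite exchange_big; apply: eq_bigr => i _ /=.
  by apply: eq_bigr => j _; ring.
rewrite E1 E2 E3 E4 -sumrB -!big_split; apply: eq_bigr => k _ /=.
rewrite -sumrB -!big_split; apply: eq_bigr => i _ /=.
rewrite -sumrB -!big_split; apply: eq_bigr => j _ /=.
by rewrite /tachibana_coef; ring.
Qed.

Lemma tachibana_delta J t k i j y :
  differentiable J y -> differentiable t y ->
  (t y)^T = t y -> J y *m t y = t y *m (J y)^T ->
  tachibana J t (cst (delta_mx 0 k)) (cst (delta_mx 0 i)) (cst (delta_mx 0 j)) y =
  tachibana_coef (J y) (t y) (pd J y) (pd t y) k i j.
Proof.
move=> dJ dt ts tp; rewrite tachibana_coefE //=.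
have sd l f : \sum_m (delta_mx 0 l : 'rV[R]_n) 0 m * f m = f l :> R.
  rewrite (bigD1 l) //= big1; first by rewrite !mxE !eqxx mul1r addr0.
  by move=> m ml; rewrite !mxE (negbTE ml) mul0r.
under eq_bigr => k' _ do under eq_bigr => i' _ do
  under eq_bigr => j' _ do rewrite -!mulrA.
under eq_bigr => k' _ do under eq_bigr => i' _ do rewrite -!mulr_sumr.
by under eq_bigr => k' _ do rewrite -mulr_sumr; rewrite !sd.
Qed.

End LocalFormulas.

Lemma derive_mx_comm {R : realType} {V : normedModType R} p q (f : V -> 'M[R]_(p, q))
    x v w (U : set V) :
  open U -> smooth U f -> U x -> 'D_w ('D_v f) x = 'D_v ('D_w f) x.
Proof.
move=> oU Cf Ux; apply/matrixP => i j.
have Cij : smooth U (fun y => f y i j) by have /(smooth_mxP oU) := Cf; exact.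
have E u u' : 'D_u ('D_u' f) x i j = 'D_u ('D_u' (fun y => f y i j)) x.
  rewrite derive_mxE; last exact: (smooth_differentiable (smooth_derive u' Cf)).
  apply: near_eq_derive; apply: open_near_eq oU _ Ux => y Uy.
  by rewrite derive_mxE //; exact: (smooth_differentiable Cf).
exact: (etrans (E w v) (etrans (derive_comm v w oU Cij Ux) (esym (E v w)))).
Qed.

(** * Levi-Civita connection and curvature in one chart *)

Section Chart.
Context {R : realType} {n : nat}.
Variables (U : set 'rV[R]_n) (g J : 'rV[R]_n -> 'M[R]_n).
Hypotheses (oU : open U) (Cg : smooth U g).
Hypothesis gs : forall y, U y -> (g y)^T = g y.
Hypothesis gu : forall y, U y -> g y \in unitmx.
Let G := christoffel_mx g.

Let dg y : U y -> differentiable g y. Proof. exact: smooth_differentiable. Qed.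

Lemma pd_trmx_id (t : 'rV[R]_n -> 'M[R]_n) y a : smooth U t -> (forall y, U y -> (t y)^T = t y) -> U y ->
  (pd t y a)^T = pd t y a.
Proof.
move=> Ct ts Uy; rewrite /pd -derive_trmx; last exact: (smooth_differentiable Ct).
by apply: near_eq_derive; apply: open_near_eq oU _ Uy => z /ts.
Qed.

Lemma christoffel_koszul y a : U y -> G y a *m g y = koszul (pd g y) a.
Proof. by move=> Uy; rewrite christoffel_mx_koszul //; [exact: dg | exact: gu | exact: gs]. Qed.

Lemma christoffel_torsion_free y : U y -> torsion_free (G y).
Proof.
move=> Uy a b h.
have E k : G y k = koszul (pd g y) k *m invmx (g y).
  by rewrite -christoffel_koszul // mulmxK // gu.
rewrite !E !mxE; apply: eq_bigr => l _; congr (_ * _).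
by apply: koszul_torsion_free => k; exact: pd_trmx_id.
Qed.

Lemma pd_metric y a : U y -> pd g y a = G y a *m g y + (G y a *m g y)^T.
Proof.
move=> Uy; rewrite christoffel_koszul // koszul_metric // => k.
exact: pd_trmx_id.
Qed.

Lemma smooth_christoffel a : smooth U (fun y => G y a).
Proof.
have Ck : smooth U (fun y => koszul (pd g y) a *m invmx (g y)).
  apply: smooth_mulmx => //; last exact: smooth_invmx.
  have Cd k i j : smooth U (fun y => pd g y k i j).
    have Cp : smooth U ('D_(delta_mx 0 k) g) by exact: smooth_derive.
    by have /(smooth_mxP oU) := Cp; exact.
  apply/(smooth_mxP oU) => b l.
  have C1 : smooth U (fun y => 2^-1 * (pd g y a b l + pd g y b a l - pd g y l a b)).
    apply: smoothM => //; first exact: smooth_cst.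
    by apply: smoothB => //; apply: smoothD.
  by apply: smooth_congr C1 => // y _; rewrite mxE.
by apply: smooth_congr Ck => // y Uy; rewrite -christoffel_koszul // mulmxK // gu.
Qed.

Definition d_christoffel y (b l : 'I_n) : 'M[R]_n := pd (fun y => G y l) y b.

Let dG y a : U y -> differentiable (fun y => G y a) y.
Proof. exact: (smooth_differentiable (smooth_christoffel a)). Qed.

Lemma d_christoffel_torsion_free y b : U y -> torsion_free (d_christoffel y b).
Proof.
move=> Uy l a h; have E k i j : d_christoffel y b k i j =
    'D_(delta_mx 0 b) (fun z => G z k i j) y := derive_mxE _ _ _ (dG k Uy).
apply: etrans (E l a h) (etrans _ (esym (E a l h))).
apply: near_eq_derive; apply: open_near_eq oU _ Uy => z Uz.
exact: christoffel_torsion_free.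
Qed.

(** Schwarz's theorem for [g]: the formula for the first derivatives holds on all of [U], so it may
    be differentiated again before the two orders are compared. *)
Lemma dd_metric y b l : U y ->
  let d b := G y b *m g y + (G y b *m g y)^T in
  let H l b := d_christoffel y b l *m g y + G y l *m d b in
  H l b + (H l b)^T = H b l + (H b l)^T.
Proof.
move=> Uy d H.
have E a k : 'D_(delta_mx 0 a) ('D_(delta_mx 0 k) g) y = H k a + (H k a)^T.
  have dGg : differentiable (fun z => G z k *m g z) y.
    by apply: differentiable_mulmx; [exact: dG | exact: dg].
  transitivity ('D_(delta_mx 0 a) (fun z => G z k *m g z + (G z k *m g z)^T) y).
    by apply: near_eq_derive; apply: open_near_eq oU _ Uy => z Uz; exact: pd_metric.
  rewrite deriveD; [|exact: diff_derivable|by apply/diff_derivable/differentiable_trmx].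
  rewrite derive_trmx // derive_mulmx; [|exact: dG|exact: dg].
  by rewrite /H /d -(pd_metric a Uy).
exact: (etrans (esym (E b l)) (etrans (derive_mx_comm _ _ oU Cg Uy) (E l b))).
Qed.

Hypothesis CJ : smooth U J.
Hypothesis nJ : forall y a, U y -> pd J y a + J y *m G y a - G y a *m J y = 0.
Hypothesis gp : forall y, U y -> J y *m g y = g y *m (J y)^T.

Let dJ y : U y -> differentiable J y. Proof. exact: smooth_differentiable. Qed.

Lemma pd_J y a : U y -> pd J y a = G y a *m J y - J y *m G y a.
Proof.
by move=> Uy; apply/eqP; rewrite -subr_eq0 opprB addrA nJ.
Qed.

Lemma dd_J y b l : U y ->
  let dJ b := G y b *m J y - J y *m G y b in
  d_christoffel y b l *m J y + G y l *m dJ b - (dJ b *m G y l + J y *m d_christoffel y b l) =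
  d_christoffel y l b *m J y + G y b *m dJ l - (dJ l *m G y b + J y *m d_christoffel y l b).
Proof.
move=> Uy dJ'.
have E a k : 'D_(delta_mx 0 a) ('D_(delta_mx 0 k) J) y =
    d_christoffel y a k *m J y + G y k *m dJ' a
    - (dJ' a *m G y k + J y *m d_christoffel y a k).
  transitivity ('D_(delta_mx 0 a) (fun z => G z k *m J z - J z *m G z k) y).
    by apply: near_eq_derive; apply: open_near_eq oU _ Uy => z Uz; exact: pd_J.
  have d1 : differentiable (fun z => G z k *m J z) y.
    by apply: differentiable_mulmx; [exact: dG | exact: dJ].
  have d2 : differentiable (fun z => J z *m G z k) y.
    by apply: differentiable_mulmx; [exact: dJ | exact: dG].
  rewrite deriveB; [|exact: diff_derivable..].
  rewrite !derive_mulmx; [|exact: dJ|exact: dG|exact: dG|exact: dJ].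
  by rewrite /dJ' -!pd_J.
exact: (etrans (esym (E b l)) (etrans (derive_mx_comm _ _ oU CJ Uy) (E l b))).
Qed.

Lemma chart_curvature_pure y a h : U y ->
  J y *m (\matrix_(b, l) curvature (G y) (d_christoffel y) b l a h) =
  (\matrix_(b, l) curvature (G y) (d_christoffel y) b l a h) *m (J y)^T.
Proof.
move=> Uy; apply: (curvature_pure (g := g y)).
- exact: gs.
- exact: gu.
- exact: gp.
- exact: christoffel_torsion_free.
- by move=> b; exact: d_christoffel_torsion_free.
- by move=> b l; exact: dd_metric.
- by move=> b l; exact: dd_J.
Qed.

End Chart.

(** * Computations in an induced chart *)

Section BlockCalculus.
Context {R : realType} {V : normedModType R}.

Lemma differentiable_block_mx {m1 m2 n1 n2 : nat} (A : V -> 'M[R]_(m1, n1))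
    (B : V -> 'M[R]_(m1, n2)) (C : V -> 'M[R]_(m2, n1)) (D : V -> 'M[R]_(m2, n2)) x :
  differentiable A x -> differentiable B x -> differentiable C x -> differentiable D x ->
  differentiable (fun y => block_mx (A y) (B y) (C y) (D y)) x.
Proof.
move=> /differentiable_mxP dA /differentiable_mxP dB /differentiable_mxP dC /differentiable_mxP dD.
apply/differentiable_mxP => i j.
case: (fintype.splitP i) => i' Ei; [have {Ei}-> : i = lshift m2 i' by exact: val_inj |
  have {Ei}-> : i = rshift m1 i' by exact: val_inj];
(case: (fintype.splitP j) => j' Ej; [have {Ej}-> : j = lshift n2 j' by exact: val_inj |
  have {Ej}-> : j = rshift n1 j' by exact: val_inj]).
- by under eq_fun do rewrite block_mxEul; exact: dA.
- by under eq_fun do rewrite block_mxEur; exact: dB.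
- by under eq_fun do rewrite block_mxEdl; exact: dC.
- by under eq_fun do rewrite block_mxEdr; exact: dD.
Qed.

Lemma derive_block_mx {m1 m2 n1 n2 : nat} (A : V -> 'M[R]_(m1, n1))
    (B : V -> 'M[R]_(m1, n2)) (C : V -> 'M[R]_(m2, n1)) (D : V -> 'M[R]_(m2, n2)) v x :
  differentiable A x -> differentiable B x -> differentiable C x -> differentiable D x ->
  'D_v (fun y => block_mx (A y) (B y) (C y) (D y)) x =
  block_mx ('D_v A x) ('D_v B x) ('D_v C x) ('D_v D x).
Proof.
move=> dA dB dC dD; apply/matrixP => i j.
rewrite (derive_mxE _ _ _ (differentiable_block_mx dA dB dC dD)).
case: (fintype.splitP i) => i' Ei; [have {Ei}-> : i = lshift m2 i' by exact: val_inj |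
  have {Ei}-> : i = rshift m1 i' by exact: val_inj];
(case: (fintype.splitP j) => j' Ej; [have {Ej}-> : j = lshift n2 j' by exact: val_inj |
  have {Ej}-> : j = rshift n1 j' by exact: val_inj]).
- under eq_fun do rewrite block_mxEul; rewrite block_mxEul.
  exact: esym (derive_mxE _ _ _ dA).
- under eq_fun do rewrite block_mxEur; rewrite block_mxEur.
  exact: esym (derive_mxE _ _ _ dB).
- under eq_fun do rewrite block_mxEdl; rewrite block_mxEdl.
  exact: esym (derive_mxE _ _ _ dC).
- under eq_fun do rewrite block_mxEdr; rewrite block_mxEdr.
  exact: esym (derive_mxE _ _ _ dD).
Qed.

Lemma smooth_block_mx (U : set V) {m1 m2 n1 n2 : nat} (A : V -> 'M[R]_(m1, n1))
    (B : V -> 'M[R]_(m1, n2)) (C : V -> 'M[R]_(m2, n1)) (D : V -> 'M[R]_(m2, n2)) :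
  open U -> smooth U A -> smooth U B -> smooth U C -> smooth U D ->
  smooth U (fun y => block_mx (A y) (B y) (C y) (D y)).
Proof.
move=> oU /(smooth_mxP oU) sA /(smooth_mxP oU) sB /(smooth_mxP oU) sC /(smooth_mxP oU) sD.
apply/(smooth_mxP oU) => i j.
case: (fintype.splitP i) => i' Ei; [have {Ei}-> : i = lshift m2 i' by exact: val_inj |
  have {Ei}-> : i = rshift m1 i' by exact: val_inj];
(case: (fintype.splitP j) => j' Ej; [have {Ej}-> : j = lshift n2 j' by exact: val_inj |
  have {Ej}-> : j = rshift n1 j' by exact: val_inj]).
- by under eq_fun do rewrite block_mxEul; exact: sA.
- by under eq_fun do rewrite block_mxEur; exact: sB.
- by under eq_fun do rewrite block_mxEdl; exact: sC.
- by under eq_fun do rewrite block_mxEdr; exact: sD.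
Qed.

Lemma derive_row_mx p q r (f : V -> 'M[R]_(p, q))
    (h : V -> 'M[R]_(p, r)) v x : differentiable f x -> differentiable h x ->
  differentiable (fun y => row_mx (f y) (h y)) x /\
  'D_v (fun y => row_mx (f y) (h y)) x = row_mx ('D_v f x) ('D_v h x).
Proof.
move=> df dh.
have drow : differentiable (fun y => row_mx (f y) (h y)) x.
  move: df dh => /differentiable_mxP df /differentiable_mxP dh; apply/differentiable_mxP => a b.
  case: (fintype.splitP b) => b' Eb; [have {Eb}-> : b = lshift r b' by exact: val_inj |
    have {Eb}-> : b = rshift q b' by exact: val_inj].
    by under eq_fun do rewrite row_mxEl; exact: df.
  by under eq_fun do rewrite row_mxEr; exact: dh.
split=> //; apply/matrixP => a b.
rewrite (derive_mxE _ _ _ drow).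
case: (fintype.splitP b) => b' Eb; [have {Eb}-> : b = lshift r b' by exact: val_inj |
  have {Eb}-> : b = rshift q b' by exact: val_inj].
  under eq_fun do rewrite row_mxEl; rewrite row_mxEl.
  exact: esym (derive_mxE _ _ _ df).
under eq_fun do rewrite row_mxEr; rewrite row_mxEr.
exact: esym (derive_mxE _ _ _ dh).
Qed.

Lemma smooth_row_mx (U : set V) p q r
    (f : V -> 'M[R]_(p, q)) (h : V -> 'M[R]_(p, r)) :
  open U -> smooth U f -> smooth U h -> smooth U (fun y => row_mx (f y) (h y)).
Proof.
move=> oU /(smooth_mxP oU) sf /(smooth_mxP oU) sh; apply/(smooth_mxP oU) => a b.
case: (fintype.splitP b) => b' Eb; [have {Eb}-> : b = lshift r b' by exact: val_inj |
  have {Eb}-> : b = rshift q b' by exact: val_inj].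
  by under eq_fun do rewrite row_mxEl; exact: sf.
by under eq_fun do rewrite row_mxEr; exact: sh.
Qed.

End BlockCalculus.

Section CotangentCoordinates.
Context {R : realType} {n : nat}.

Lemma derive_lsubmx (W : normedModType R) (f : 'rV[R]_n -> W) (v z : 'rV[R]_(n + n)) :
  differentiable f (lsubmx z) ->
  'D_v (fun z => f (lsubmx z)) z = 'D_(lsubmx v) f (lsubmx z).
Proof.
move=> df; have dl := @differentiable_lsubmx R 1 n n z.
have dc := differentiable_comp dl df.
rewrite (deriveE _ df); apply: etrans (deriveE _ dc) _.
by rewrite diff_comp //= diff_lin //; exact: continuous_lsubmx.
Qed.

Lemma differentiable_base (W : normedModType R) (f : 'rV[R]_n -> W) (z : 'rV[R]_(n + n)) :
  differentiable f (lsubmx z) -> differentiable (fun z => f (lsubmx z)) z.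
Proof. exact: differentiable_comp (@differentiable_lsubmx R 1 n n z). Qed.

Lemma derive_rsubmx (v z : 'rV[R]_(n + n)) :
  'D_v (rsubmx : 'rV[R]_(n + n) -> 'rV[R]_n) z = rsubmx v.
Proof.
rewrite deriveE ?diff_lin //; first exact: continuous_rsubmx.
exact: differentiable_rsubmx.
Qed.

Definition cylinder (U : set 'rV[R]_n) : set 'rV[R]_(n + n) := [set z | U (lsubmx z)].

Lemma open_cylinder U : open U -> open (cylinder U).
Proof. by move=> oU; apply: open_comp => // z _; exact: continuous_lsubmx. Qed.

Lemma smooth_base (U : set 'rV[R]_n) p q (f : 'rV[R]_n -> 'M[R]_(p, q)) :
  open U -> smooth U f -> smooth (cylinder U) (fun z => f (lsubmx z)).
Proof.
move=> oU Cf; apply: (smooth_comp (open_cylinder oU) oU _ _ Cf) => //.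
exact: (smooth_linear (open_cylinder oU) (L := lsubmx) (@continuous_lsubmx _ _ _ _) (@smooth_id _ _ _)).
Qed.

Lemma smooth_rsubmx (U : set 'rV[R]_(n + n)) :
  open U -> smooth U (rsubmx : 'rV[R]_(n + n) -> 'rV[R]_n).
Proof.
move=> oU.
exact: (smooth_linear oU (L := rsubmx) (@continuous_rsubmx _ _ _ _) (@smooth_id _ _ _)).
Qed.

Variable g : 'rV[R]_n -> 'M[R]_n.
Let G := christoffel_mx g.

(** The matrix p_h Gamma^h_lb: the fibre part of the horizontal lifts, and the block called [N] in
    the algebra above. *)
Definition frame_mx (z : 'rV[R]_(n + n)) : 'M[R]_n :=
  \matrix_(b, l) \sum_h rsubmx z 0 h * G (lsubmx z) l b h.

Lemma frame_mxE z b l : frame_mx z b l = (rsubmx z *m (G (lsubmx z) l)^T) 0 b.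
Proof. by rewrite !mxE; apply: eq_bigr => h _; rewrite [_^T h b]mxE. Qed.

Lemma adapted_frame_block z :
  adapted_frame g (lsubmx z) (rsubmx z) = block_mx 1%:M (frame_mx z) 0 1%:M.
Proof.
rewrite adapted_frameE; congr block_mx; apply/matrixP => b l; rewrite [LHS]mxE [RHS]mxE.
by apply: eq_bigr => h _; rewrite [G _ _ _ _]mxE.
Qed.

Lemma invmx_frame (N : 'M[R]_n) :
  invmx (block_mx 1%:M N 0 1%:M) = block_mx 1%:M (- N) 0 1%:M.
Proof.
have E : block_mx 1%:M (- N) 0 1%:M *m block_mx 1%:M N 0 1%:M = 1%:M :> 'M[R]_(n + n).
  rewrite mulmx_block !(mul1mx, mulmx1, mul0mx, mulmx0, addr0, add0r) subrr.
  by rewrite -scalar_mx_block.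
have [_ uF] := mulmx1_unit E.
by rewrite -[RHS](mulmxK uF) E mul1mx.
Qed.

Lemma riem_ext_mx_block c z :
  riem_ext_mx g c z = riem_ext_block (c (lsubmx z)) (frame_mx z).
Proof.
rewrite /riem_ext_mx adapted_frame_block invmx_frame tr_block_mx !mulmx_block.
by rewrite !(mul1mx, mulmx1, mul0mx, mulmx0, addr0, add0r, trmx1, trmx0, trmxN).
Qed.

Lemma hlift_mx_block J z :
  hlift_mx g J z = hlift_block (J (lsubmx z)) (frame_mx z).
Proof.
rewrite /hlift_mx adapted_frame_block invmx_frame !mulmx_block.
rewrite !(mul1mx, mulmx1, mul0mx, mulmx0, addr0, add0r).
by rewrite mulNmx.
Qed.

Lemma riem_ext_block_unit (c N : 'M[R]_n) : riem_ext_block c N \in unitmx.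
Proof.
have E : riem_ext_block c N *m block_mx 0 1%:M 1%:M (- (c - N - N^T)) = 1%:M.
  rewrite /riem_ext_block mulmx_block !(mul1mx, mulmx1, mul0mx, mulmx0, addr0, add0r).
  by rewrite subrr -scalar_mx_block.
by have [] := mulmx1_unit E.
Qed.

Lemma riem_ext_block_sym (c N : 'M[R]_n) : c^T = c -> (riem_ext_block c N)^T = riem_ext_block c N.
Proof.
move=> cs; rewrite /riem_ext_block tr_block_mx !(trmxD, trmxN, trmxK, trmx1, trmx0) cs.
by rewrite addrAC.
Qed.

Lemma hlift_block_pure (J c N : 'M[R]_n) : J *m c = c *m J^T ->
  hlift_block J N *m riem_ext_block c N = riem_ext_block c N *m (hlift_block J N)^T.
Proof.
move=> Jc; rewrite /hlift_block /riem_ext_block tr_block_mx !mulmx_block.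
rewrite !(mul1mx, mulmx1, mul0mx, mulmx0, addr0, add0r, trmx0, trmxK); congr block_mx.
rewrite !dist_mxE Jc; apply/matrixP => i j; rewrite !zmxE; ring.
Qed.

Lemma hlift_block_sq (J N : 'M[R]_n) : J *m J = - 1%:M ->
  hlift_block J N *m hlift_block J N = - 1%:M.
Proof.
move=> JJ; rewrite /hlift_block !mulmx_block !(mul0mx, mulmx0, addr0, add0r).
rewrite -trmx_mul JJ scalar_mx_block opp_block_mx oppr0 trmxN trmx1; congr block_mx.
rewrite mulmxBr mulmxBl !mulmxA JJ -[N *m J^T *m J^T]mulmxA -trmx_mul JJ trmxN trmx1.
by apply/matrixP => i j; rewrite !dist_mxE mul1mx mulmx1 !zmxE; ring.
Qed.

End CotangentCoordinates.

Section CotangentChart.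
Context {R : realType} {n : nat}.
Variables (U : set 'rV[R]_n) (g J c : 'rV[R]_n -> 'M[R]_n).
Hypotheses (oU : open U) (Cg : smooth U g).
Hypothesis gs : forall y, U y -> (g y)^T = g y.
Hypothesis gu : forall y, U y -> g y \in unitmx.
Hypothesis CJ : smooth U J.
Hypothesis Cc : smooth U c.
Let G := christoffel_mx g.
Hypothesis nJ : forall y a, U y -> pd J y a + J y *m G y a - G y a *m J y = 0.
Hypothesis gp : forall y, U y -> J y *m g y = g y *m (J y)^T.

Let CG a : smooth U (fun y => G y a).
Proof. exact: smooth_christoffel. Qed.

Lemma smooth_frame : smooth (cylinder U) (frame_mx g).
Proof.
have oO := open_cylinder oU.
apply/(smooth_mxP oO) => b l.
have C1 : smooth (cylinder U) (fun z => rsubmx z *m (G (lsubmx z) l)^T).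
  apply: smooth_mulmx => //; first exact: smooth_rsubmx.
  by apply: smooth_trmx => //; exact: (smooth_base oU (CG l)).
have C2 := (smooth_mxP oO _).1 C1 0 b.
by apply: smooth_congr C2 => // z _; rewrite frame_mxE.
Qed.

Lemma smooth_riem_ext : smooth (cylinder U) (riem_ext_mx g c).
Proof.
have oO := open_cylinder oU.
have C1 : smooth (cylinder U) (fun z => riem_ext_block (c (lsubmx z)) (frame_mx g z)).
  apply: smooth_block_mx => //; try exact: smooth_cst.
  apply: smoothB => //; last by apply: smooth_trmx => //; exact: smooth_frame.
  by apply: smoothB => //; [exact: smooth_base | exact: smooth_frame].
by apply: smooth_congr C1 => // z _; rewrite riem_ext_mx_block.
Qed.

Lemma smooth_hlift : smooth (cylinder U) (hlift_mx g J).
Proof.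
have oO := open_cylinder oU.
have CJb : smooth (cylinder U) (fun z => J (lsubmx z)) by exact: smooth_base.
have CJt : smooth (cylinder U) (fun z => (J (lsubmx z))^T) by exact: smooth_trmx.
have CN := smooth_frame.
have C1 : smooth (cylinder U) (fun z => hlift_block (J (lsubmx z)) (frame_mx g z)).
  apply: smooth_block_mx => //; try exact: smooth_cst.
  by apply: smoothB => //; exact: smooth_mulmx.
by apply: smooth_congr C1 => // z _; rewrite hlift_mx_block.
Qed.

Let dN z a : 'M[R]_n :=
  \matrix_(b, l) \sum_h rsubmx z 0 h * d_christoffel g (lsubmx z) a l b h.

Lemma derive_frame z v b l : cylinder U z -> 'D_v (frame_mx g) z b l =
  (rsubmx v *m (G (lsubmx z) l)^T
   + rsubmx z *m ('D_(lsubmx v) (fun y => G y l) (lsubmx z))^T) 0 b.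
Proof.
move=> Uz; have dGl := smooth_differentiable (CG l) Uz.
have dGb := differentiable_base dGl.
rewrite (derive_mxE _ _ _ (smooth_differentiable smooth_frame Uz)).
under eq_fun do rewrite frame_mxE.
have dr := @differentiable_rsubmx R 1 n n z.
have dGt := differentiable_trmx dGb.
rewrite -(derive_lsubmx _ dGl) -(derive_trmx _ dGb) -[X in X *m _ + _](derive_rsubmx v z).
rewrite -(derive_mulmx _ dr dGt); symmetry; apply: derive_mxE.
exact: differentiable_mulmx.
Qed.

Lemma lsubmx_deltal a : lsubmx (delta_mx 0 (lshift n a) : 'rV[R]_(n + n)) = delta_mx 0 a.
Proof. by apply/rowP => i; rewrite !mxE eq_lshift. Qed.
Lemma rsubmx_deltal a : rsubmx (delta_mx 0 (lshift n a) : 'rV[R]_(n + n)) = 0.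
Proof. by apply/rowP => i; rewrite !mxE eq_rlshift. Qed.
Lemma lsubmx_deltar a : lsubmx (delta_mx 0 (rshift n a) : 'rV[R]_(n + n)) = 0.
Proof. by apply/rowP => i; rewrite !mxE eq_lrshift. Qed.
Lemma rsubmx_deltar a : rsubmx (delta_mx 0 (rshift n a) : 'rV[R]_(n + n)) = delta_mx 0 a.
Proof. by apply/rowP => i; rewrite !mxE eq_rshift. Qed.

Lemma pd_frame_l z a : cylinder U z -> pd (frame_mx g) z (lshift n a) = dN z a.
Proof.
move=> Uz; apply/matrixP => b l.
rewrite /pd derive_frame // lsubmx_deltal rsubmx_deltal mul0mx add0r !mxE.
by apply: eq_bigr => h _; rewrite [_^T _ _]mxE.
Qed.

Lemma pd_frame_r z a : cylinder U z -> pd (frame_mx g) z (rshift n a) = vmx (G (lsubmx z)) a.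
Proof.
move=> Uz; apply/matrixP => b l.
rewrite /pd derive_frame // lsubmx_deltar rsubmx_deltar derive0 trmx0 mulmx0 addr0.
by rewrite -rowE !mxE.
Qed.

Let riem_extE : riem_ext_mx g c = fun z => riem_ext_block (c (lsubmx z)) (frame_mx g z).
Proof. by apply/funext => z; rewrite riem_ext_mx_block. Qed.

Let hliftE : hlift_mx g J = fun z => hlift_block (J (lsubmx z)) (frame_mx g z).
Proof. by apply/funext => z; rewrite hlift_mx_block. Qed.

Let dN_ z : cylinder U z -> differentiable (frame_mx g) z.
Proof. exact: (smooth_differentiable smooth_frame). Qed.
Let dc_ y : U y -> differentiable c y.
Proof. exact: (smooth_differentiable Cc). Qed.
Let dJ_ y : U y -> differentiable J y.
Proof. exact: (smooth_differentiable CJ). Qed.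

Lemma derive_riem_ext z v : cylinder U z -> 'D_v (riem_ext_mx g c) z =
  block_mx ('D_(lsubmx v) c (lsubmx z) - 'D_v (frame_mx g) z - ('D_v (frame_mx g) z)^T) 0 0 0.
Proof.
move=> Uz; rewrite riem_extE.
have dcz := differentiable_base (dc_ Uz); have dN' := dN_ Uz.
have dNT := differentiable_trmx dN'.
have dcN : differentiable (fun z => c (lsubmx z) - frame_mx g z) z.
  exact: differentiableB.
have d1 : differentiable (cst 1%:M : _ -> 'M[R]_n) z by exact: differentiable_cst.
have d0 : differentiable (cst 0 : _ -> 'M[R]_n) z by exact: differentiable_cst.
rewrite [LHS](derive_block_mx _ (differentiableB dcN dNT) d1 d1 d0) !derive_cst.
congr block_mx; rewrite [LHS](deriveB (diff_derivable dcN) (diff_derivable dNT)).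
rewrite derive_trmx //; congr (_ - _).
by rewrite [LHS](deriveB (diff_derivable dcz) (diff_derivable dN')) derive_lsubmx //; exact: dc_.
Qed.

Lemma derive_hlift z v : cylinder U z -> 'D_v (hlift_mx g J) z =
  let dJ := 'D_(lsubmx v) J (lsubmx z) in let dN := 'D_v (frame_mx g) z in
  block_mx dJ (dJ *m frame_mx g z + J (lsubmx z) *m dN
               - (dN *m (J (lsubmx z))^T + frame_mx g z *m dJ^T)) 0 dJ^T.
Proof.
move=> Uz /=; set dJ := 'D_(lsubmx v) J (lsubmx z); rewrite hliftE.
have dJz := differentiable_base (dJ_ Uz); have dN' := dN_ Uz.
have dJT := differentiable_trmx dJz.
have d0 : differentiable (cst 0 : _ -> 'M[R]_n) z by exact: differentiable_cst.
have d1 := differentiable_mulmx dJz dN'; have d2 := differentiable_mulmx dN' dJT.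
rewrite [LHS](derive_block_mx _ dJz (differentiableB d1 d2) d0 dJT) derive_cst.
have EJ : 'D_v (fun z => J (lsubmx z)) z = dJ by rewrite derive_lsubmx //; exact: dJ_.
have EJT : 'D_v (fun z => (J (lsubmx z))^T) z = dJ^T.
  by rewrite (derive_trmx _ dJz) EJ.
rewrite EJ EJT; congr block_mx.
rewrite [LHS](deriveB (diff_derivable d1) (diff_derivable d2)).
by rewrite (derive_mulmx _ dJz dN') (derive_mulmx _ dN' dJT) EJ EJT.
Qed.

Lemma pd_riem_ext z k : cylinder U z ->
  pd (riem_ext_mx g c) z k = d_riem_ext (G (lsubmx z)) (pd c (lsubmx z)) (dN z) k.
Proof.
move=> Uz; rewrite /pd derive_riem_ext // /d_riem_ext.
case: (fintype.splitP k) => a Ea; [have {Ea}-> : k = lshift n a by exact: val_inj |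
  have {Ea}-> : k = rshift n a by exact: val_inj].
  by rewrite (pd_frame_l a Uz : 'D_(delta_mx 0 (lshift n a)) (frame_mx g) z = dN z a)
    lsubmx_deltal.
by rewrite (pd_frame_r a Uz : 'D_(delta_mx 0 (rshift n a)) (frame_mx g) z = vmx (G (lsubmx z)) a)
  lsubmx_deltar derive0 sub0r.
Qed.

Lemma pd_hlift z k : cylinder U z ->
  pd (hlift_mx g J) z k = d_hlift (J (lsubmx z)) (frame_mx g z) (G (lsubmx z))
    (pd J (lsubmx z)) (dN z) k.
Proof.
move=> Uz; rewrite /pd derive_hlift // /d_hlift.
case: (fintype.splitP k) => a Ea; [have {Ea}-> : k = lshift n a by exact: val_inj |
  have {Ea}-> : k = rshift n a by exact: val_inj].
  by rewrite (pd_frame_l a Uz : 'D_(delta_mx 0 (lshift n a)) (frame_mx g) z = dN z a)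
    lsubmx_deltal.
by rewrite (pd_frame_r a Uz : 'D_(delta_mx 0 (rshift n a)) (frame_mx g) z = vmx (G (lsubmx z)) a)
  lsubmx_deltar derive0 trmx0 mulmx0 mul0mx add0r addr0.
Qed.

(** The right-hand side sees only the base point of [z]: parallelism at one covector is equivalent
    to parallelism at every covector over the same point. *)
Lemma chart_parallel z : cylinder U z -> (c (lsubmx z))^T = c (lsubmx z) ->
  J (lsubmx z) *m c (lsubmx z) = c (lsubmx z) *m (J (lsubmx z))^T ->
  (forall k, pd (hlift_mx g J) z k
     + hlift_mx g J z *m christoffel_mx (riem_ext_mx g c) z k
     - christoffel_mx (riem_ext_mx g c) z k *m hlift_mx g J z = 0) <->
  (forall a, pd J (lsubmx z) a *m c (lsubmx z)
     + J (lsubmx z) *m koszul (pd c (lsubmx z)) a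
     = koszul (pd c (lsubmx z)) a *m (J (lsubmx z))^T).
Proof.
move=> Uz cs cp.
have Ug : riem_ext_mx g c z \in unitmx by rewrite riem_ext_mx_block riem_ext_block_unit.
have Sg : (riem_ext_mx g c z)^T = riem_ext_mx g c z.
  by rewrite riem_ext_mx_block riem_ext_block_sym.
have Pg : hlift_mx g J z *m riem_ext_mx g c z = riem_ext_mx g c z *m (hlift_mx g J z)^T.
  by rewrite riem_ext_mx_block hlift_mx_block hlift_block_pure.
have dg' : differentiable (riem_ext_mx g c) z := smooth_differentiable smooth_riem_ext Uz.
have LE k : christoffel_mx (riem_ext_mx g c) z k *m riem_ext_mx g c z =
    koszul (d_riem_ext (G (lsubmx z)) (pd c (lsubmx z)) (dN z)) k.
  rewrite christoffel_mx_koszul //; congr (koszul _ k); apply/funext => l.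
  exact: pd_riem_ext.
have parE k := koszul_pure (pd (hlift_mx g J) z k) Ug Pg (LE k).
have tf : torsion_free (G (lsubmx z)) := christoffel_torsion_free oU Cg gs gu Uz.
have dtf b : torsion_free (d_christoffel g (lsubmx z) b) :=
  d_christoffel_torsion_free oU Cg gs gu b Uz.
have NE b l : frame_mx g z b l = \sum_h rsubmx z 0 h * G (lsubmx z) l b h by rewrite mxE.
have dNE a b l : dN z a b l = \sum_h rsubmx z 0 h * d_christoffel g (lsubmx z) a l b h.
  by rewrite mxE.
have AE a : pd J (lsubmx z) a = G (lsubmx z) a *m J (lsubmx z) - J (lsubmx z) *m G (lsubmx z) a.
  exact: (pd_J nJ a Uz).
have cJ a h := chart_curvature_pure oU Cg gs gu CJ nJ gp a h Uz.
have hE a := hlift_parallel_h (c (lsubmx z)) (pd c (lsubmx z)) tf dtf NE dNE AE cJ a.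
split=> H.
  move=> a; apply/hE; rewrite -pd_hlift // -riem_ext_mx_block -hlift_mx_block.
  by apply/parE.
move=> k; apply/parE; rewrite pd_hlift // riem_ext_mx_block hlift_mx_block.
case: (fintype.splitP k) => a Ea; [have {Ea}-> : k = lshift n a by exact: val_inj |
  have {Ea}-> : k = rshift n a by exact: val_inj].
  by apply/hE.
exact: hlift_parallel_v.
Qed.

End CotangentChart.

(** * Changes of coordinates *)

Section Jacobian.
Context {R : realType}.

Lemma jacobianE m n (f : 'rV[R]_m -> 'rV[R]_n) y a b :
  differentiable f y -> 'J f y a b = pd f y a 0 b.
Proof.
by move=> df; rewrite /pd deriveEjacobian // -rowE [RHS]mxE.
Qed.

Lemma jacobian_comp m n p (f : 'rV[R]_m -> 'rV[R]_n) (h : 'rV[R]_n -> 'rV[R]_p) y :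
  differentiable f y -> differentiable h (f y) ->
  'J (h \o f) y = 'J f y *m 'J h (f y).
Proof.
move=> df dh; have dc := differentiable_comp df dh.
apply/row_matrixP => a; rewrite !rowE mulmxA.
rewrite -(deriveEjacobian _ dc) -(deriveEjacobian _ df) -(deriveEjacobian _ dh).
by rewrite (deriveE _ dc) diff_comp //= (deriveE _ df) (deriveE _ dh).
Qed.

Lemma near_eq_jacobian m n (f h : 'rV[R]_m -> 'rV[R]_n) y :
  (\near y, f y = h y) -> differentiable f y -> 'J f y = 'J h y.
Proof.
move=> fh df; have dh := near_eq_differentiable fh df.
apply/row_matrixP => a; rewrite [LHS]rowE [RHS]rowE.
apply: etrans (esym (deriveEjacobian _ df)) (etrans _ (deriveEjacobian _ dh)).
exact: near_eq_derive.
Qed.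

Lemma jacobian_id n (y : 'rV[R]_n) : 'J id y = 1%:M.
Proof.
apply/row_matrixP => a; rewrite rowE -deriveEjacobian // derive_id.
by rewrite row1.
Qed.

End Jacobian.

Section Transitions.
Context {R : realType} {n : nat} {M : topologicalType} (A : atlas R n M).
Hypothesis mA : is_manifold A.
Implicit Types (i j k : idx A) (x : M) (y : 'rV[R]_n).

Lemma open_dom i : open (dom i).
Proof. by have [_ _ _ /(_ i) [] ] := mA. Qed.

Lemma coord_inj i x x' : dom i x -> dom i x' -> coord i x = coord i x' -> x = x'.
Proof.
by have [_ _ _ /(_ i) [_ inj _ _] _] := mA => dx dx'; apply: inj; rewrite inE.
Qed.

Lemma coord_open i (O : set M) : open O -> O `<=` dom i -> open (coord i @` O).
Proof. by have [_ _ _ /(_ i) [] ] := mA => _ _ _ + _; exact. Qed.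

Lemma open_cod i : open (cod i).
Proof. by apply: coord_open => //; exact: open_dom. Qed.

Lemma open_overlap i j : open (overlap i j).
Proof.
by apply: coord_open => [|x []//]; apply: openI; exact: open_dom.
Qed.

Lemma transition_coord i j x : dom i x -> dom j x ->
  transition i j (coord i x) = coord j x.
Proof.
move=> ix jx; rewrite /transition; case: xgetP => [z -> [x' [ix' jx' E] <-]|/(_ (coord j x))].
  by rewrite (coord_inj ix' ix E).
by case; exists x.
Qed.

Lemma smooth_transition i j : smooth (overlap i j) (transition i j).
Proof. by have [_ _ _ _] := mA; exact. Qed.

Lemma overlapP i j y : overlap i j y ->
  exists x, [/\ dom i x, dom j x, y = coord i x & transition i j y = coord j x].
Proof.
by move=> [x [ix jx] <-]; exists x; split=> //; exact: transition_coord.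
Qed.

Lemma overlap_coord i j x : dom i x -> dom j x -> overlap i j (coord i x).
Proof. by move=> ix jx; exists x. Qed.

Lemma overlap_sub i j : overlap i j `<=` cod i.
Proof. by move=> _ [x [ix _] <-]; exists x. Qed.

Lemma transition_cod i j y : overlap i j y -> overlap j i (transition i j y).
Proof. by move=> /overlapP[x [ix jx -> ->]]; exact: overlap_coord. Qed.

Lemma transitionK i j y : overlap i j y -> transition j i (transition i j y) = y.
Proof. by move=> /overlapP[x [ix jx -> ->]]; exact: transition_coord. Qed.

Lemma differentiable_transition i j y : overlap i j y -> differentiable (transition i j) y.
Proof. exact: (smooth_differentiable (@smooth_transition i j)). Qed.

(** The chain rule; the transition maps compose on the image of the triple overlap, which is
    open. *)
Lemma tjac_comp i j k x : dom i x -> dom j x -> dom k x ->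
  tjac i k (coord i x) = tjac i j (coord i x) *m tjac j k (coord j x).
Proof.
move=> ix jx kx; rewrite /tjac -(transition_coord ix jx) -jacobian_comp.
- symmetry; apply: near_eq_jacobian.
    have oW : open (coord i @` (dom i `&` dom j `&` dom k)).
      by apply: coord_open => [|x' [[]]//]; do 2?apply: openI; exact: open_dom.
    apply: (open_near_eq oW); last by exists x.
    by move=> _ [x' [[ix' jx'] kx'] <-] /=; rewrite !transition_coord.
  apply: differentiable_comp; first exact/differentiable_transition/overlap_coord.
  by rewrite transition_coord //; exact/differentiable_transition/overlap_coord.
- exact/differentiable_transition/overlap_coord.
- by rewrite transition_coord //; exact/differentiable_transition/overlap_coord.
Qed.

Lemma tjac_id i y : cod i y -> tjac i i y = 1%:M.
Proof.
move=> iy; rewrite -(jacobian_id y); symmetry; apply: near_eq_jacobian => //.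
apply: open_near_eq (@open_cod i) _ iy => _ [x ix <-].
by rewrite transition_coord.
Qed.

Lemma tjacK i j y : overlap i j y -> tjac i j y *m tjac j i (transition i j y) = 1%:M.
Proof.
move=> /overlapP[x [ix jx -> ->]]; rewrite -tjac_comp // tjac_id //.
by exists x.
Qed.

Lemma tjacVK i j y : overlap i j y -> tjac j i (transition i j y) *m tjac i j y = 1%:M.
Proof. by move=> /tjacK /mulmx1C. Qed.

Lemma tjacE i j y a b : overlap i j y -> tjac i j y a b = pd (transition i j) y a 0 b.
Proof. by move=> oy; rewrite jacobianE //; exact: differentiable_transition. Qed.

Lemma smooth_tjac i j : smooth (overlap i j) (tjac i j).
Proof.
apply/(smooth_mxP (@open_overlap i j)) => a b.
have C := smooth_derive (delta_mx 0 a) (@smooth_transition i j).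
have C' := (smooth_mxP (@open_overlap i j) _).1 C 0 b.
apply: (smooth_congr (@open_overlap i j) _ C') => y oy.
by rewrite tjacE.
Qed.

(** Schwarz's theorem for the change of coordinates. It is the torsion-freeness of [dT] in the lemma
    below. *)
Lemma tjac_symm i j y a b (k : 'I_n) : overlap i j y ->
  pd (tjac i j) y a b k = pd (tjac i j) y b a k.
Proof.
move=> oy; have oo := @open_overlap i j.
have E a' b' : pd (tjac i j) y a' b' k =
    'D_(delta_mx 0 a') ('D_(delta_mx 0 b') (transition i j)) y 0 k.
  have dT := smooth_differentiable (@smooth_tjac i j) oy.
  have dD := smooth_differentiable (smooth_derive (delta_mx 0 b') (@smooth_transition i j)) oy.
  apply: etrans (derive_mxE _ _ _ dT) _; apply: etrans _ (esym (derive_mxE _ _ _ dD)).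
  by apply: near_eq_derive; apply: (open_near_eq oo _ oy) => z oz; rewrite tjacE.
have /(congr1 (fun B : 'rV[R]_n => B 0 k)) H :=
  derive_mx_comm (delta_mx 0 b) (delta_mx 0 a) oo (@smooth_transition i j) oy.
exact: etrans (E a b) (etrans H (esym (E b a))).
Qed.

(** The Koszul formula itself is not transformed. The candidate [S b *m T'] is torsion-free and
    compatible with the derivatives [d] of the metric, so by [koszul_unique] it has the same lowered
    symbols as [G]. *)
Lemma christoffel_change_algebra (T T' g g' : 'M[R]_n)
    (dT G' d G : 'I_n -> 'M[R]_n) :
  T *m T' = 1%:M -> g = T *m g' *m T^T -> g \in unitmx -> g'^T = g' ->
  torsion_free dT -> torsion_free G' ->
  (forall b, d b = (dT b *m g'
     + T *m (\sum_c T b c *: (G' c *m g' + (G' c *m g')^T))) *m T^T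
     + T *m g' *m (dT b)^T) ->
  (forall a, G a *m g = koszul d a) ->
  forall a, G a *m T = dT a + \sum_c T a c *: (T *m G' c).
Proof.
move=> TT' gE gu gs' tfT tfG' dE GE a; have T'T := mulmx1C TT'.
pose S b := dT b + \sum_c T b c *: (T *m G' c).
have SgE b : (S b *m T') *m g = S b *m g' *m T^T.
  by rewrite gE !mulmxA -[S b *m T' *m T]mulmxA T'T mulmx1.
have tfS : torsion_free S.
  move=> b e h; rewrite /S !addmxE (tfT b e); congr (_ + _).
  rewrite !summxE.
  under eq_bigr => l _ do rewrite scalemxE mxE mulr_sumr.
  under [RHS]eq_bigr => l _ do rewrite scalemxE mxE mulr_sumr.
  rewrite exchange_big; apply: eq_bigr => l _; apply: eq_bigr => m _ /=.
  by rewrite (tfG' l m) mulrCA.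
have tfST : torsion_free (fun b => S b *m T').
  by move=> b e h; rewrite !mxE; apply: eq_bigr => l _; rewrite tfS.
have dS b : d b = S b *m T' *m g + (S b *m T' *m g)^T.
  rewrite dE SgE /S.
  have -> : \sum_c T b c *: (G' c *m g' + (G' c *m g')^T) =
    (\sum_c T b c *: G' c) *m g' + ((\sum_c T b c *: G' c) *m g')^T.
    rewrite mulmx_suml raddf_sum -big_split /=; apply: eq_bigr => c _.
    by rewrite scalerDr -scalemxAl trmxZ.
  have -> : \sum_c T b c *: (T *m G' c) = T *m \sum_c T b c *: G' c.
    by rewrite mulmx_sumr; apply: eq_bigr => c _; rewrite scalemxAr.
  set K := \sum_c _; apply/matrixP => k l.
  by rewrite !dist_mxE !gs' !zmxE; ring.
have E := koszul_unique tfST dS a.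
have E2 : G a *m g = S a *m T' *m g by rewrite GE E.
have E3 := can_inj (mulmxK gu) E2.
by rewrite E3 -mulmxA T'T mulmx1.
Qed.

Section ChristoffelLaw.
Variable g : mx_field A.
Hypothesis tg : is_tensor02 g.
Hypothesis gs : forall i y, cod i y -> (g i y)^T = g i y.
Hypothesis gu : forall i y, cod i y -> g i y \in unitmx.

Lemma christoffel_change i j y a : overlap i j y ->
  christoffel_mx (g i) y a *m tjac i j y =
  pd (tjac i j) y a + \sum_c tjac i j y a c *:
    (tjac i j y *m christoffel_mx (g j) (transition i j y) c).
Proof.
move=> oy; have iy := overlap_sub oy; have oy' := transition_cod oy.
have jy := overlap_sub oy'; have [Cg lg] := tg.
have tfG' := christoffel_torsion_free (@open_cod j) (Cg j) (@gs j) (@gu j) jy.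
have dT := smooth_differentiable (@smooth_tjac i j) oy.
have df := differentiable_transition oy.
have dgj := smooth_differentiable (Cg j) jy.
have dgf : differentiable (g j \o transition i j) y by exact: differentiable_comp.
have dTT := differentiable_trmx dT.
have dTg := differentiable_mulmx dT dgf.
apply: (christoffel_change_algebra (T' := tjac j i (transition i j y)) (g := g i y)
  (g' := g j (transition i j y)) (d := pd (g i) y)).
- exact: tjacK.
- exact: lg.
- exact: gu.
- exact: gs.
- by move=> b e h; exact: tjac_symm.
- exact: tfG'.
- move=> b.
  have E1 : pd (g i) y b =
      'D_(delta_mx 0 b) (fun z => tjac i j z *m (g j \o transition i j) z *m (tjac i j z)^T) y.
    by apply: near_eq_derive; apply: (open_near_eq (@open_overlap i j) _ oy) => z /lg.
  have E2 : 'D_(delta_mx 0 b) (g j \o transition i j) y =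
      \sum_c tjac i j y b c *: (christoffel_mx (g j) (transition i j y) c *m g j (transition i j y)
        + (christoffel_mx (g j) (transition i j y) c *m g j (transition i j y))^T).
    apply: etrans (derive_comp_rowE _ df dgj) _.
    apply: eq_bigr => c _; rewrite [X in X *: _ = _](esym (tjacE b c oy)); congr (_ *: _).
    exact: (pd_metric (@open_cod j) (Cg j) (@gs j) (@gu j) c jy).
  apply: (etrans E1); apply: etrans (derive_mulmx _ dTg dTT) _.
  by rewrite (derive_mulmx _ dT dgf) (derive_trmx _ dT) E2.
- move=> b; exact: (christoffel_koszul (Cg i) (@gs i) (@gu i) b iy).
Qed.

End ChristoffelLaw.
End Transitions.

Arguments open_dom {R n M A} mA i.
Arguments open_cod {R n M A} mA i.
Arguments open_overlap {R n M A} mA i j.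
Arguments smooth_transition {R n M A} mA i j.
Arguments smooth_tjac {R n M A} mA i j.

(** * The cotangent bundle as a manifold *)

Section RationalBoxes.
Context {R : realType} {m : nat}.

Definition rat_box (q : {ffun 'I_m -> rat * rat}) : set 'rV[R]_m :=
  [set v | forall k, ratr (q k).1 < v 0 k < ratr (q k).2].

Lemma open_rat_box q : open (rat_box q).
Proof.
rewrite openE => v qv.
suff : nbhs v [set w : 'rV[R]_m | forall k, ratr (q k).1 < w 0 k < ratr (q k).2] by [].
apply: (@filter_forall _ _ (fun (k : 'I_m) (w : 'rV[R]_m) =>
  ratr (q k).1 < w 0 k < ratr (q k).2) (nbhs v)).
move=> k; have /andP[a b] := qv k.
have ca : {for v, continuous (fun w : 'rV[R]_m => w 0 k)} by exact: coord_continuous.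
near=> w; apply/andP; split; near: w.
  by apply: (cvgr_gt _ ca).
by apply: (cvgr_lt _ ca).
Unshelve. all: by end_near. Qed.

(** A max-norm ball of radius e about [v] contains a rational box about [v], with k-th end points
    chosen between v_k - e and v_k and between v_k and v_k + e. *)
Lemma row_second_countable : @second_countable 'rV[R]_m.
Proof.
exists (range rat_box).
  apply: (card_le_trans (card_image_le _ _)); exact: countableP.
split=> [_ [q _ <-]|v W Wv]; first exact: open_rat_box.
have [e /= e0 eW] := (nbhs_ballP v W).1 Wv.
have H k : exists ab : rat * rat, [&& v 0 k - e < ratr ab.1, ratr ab.1 < v 0 k,
    v 0 k < ratr ab.2 & ratr ab.2 < v 0 k + e].
  have [|a] := @rat_in_itvoo R (v 0 k - e) (v 0 k); first by rewrite ltrBlDr ltrDl.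
  have [|b] := @rat_in_itvoo R (v 0 k) (v 0 k + e); first by rewrite ltrDl.
  by rewrite !in_itv /= => /andP[b1 b2] /andP[a1 a2]; exists (a, b); apply/and4P.
pose q := [ffun k => xchoose (H k)].
have Hq k := xchooseP (H k).
exists (rat_box q); first split; first by exists q.
  by move=> k; rewrite ffunE; have /and4P[_ -> -> _] := Hq k.
move=> w qw; apply: eW; split => // i k; rewrite ord1 /ball /= ltr_distlC.
have /and4P[a1 a2 b1 b2] := Hq k; have := qw k; rewrite ffunE => /andP[c1 c2].
by rewrite (lt_trans a1 c1) (lt_trans c2 b2).
Qed.

End RationalBoxes.

Section CotangentManifold.
Context {R : realType} {n : nat} {M : topologicalType} (A : atlas R n M).
Hypothesis mA : is_manifold A.
Implicit Types (i j k : idx A) (x : M) (z : 'rV[R]_(n + n)) (xi : cotangent A).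

(** [comp_change] recovers the components in all charts around the base point from those in one of
    them, and [comp_out] fixes the others at 0. *)
Lemma covector_ext xi xi' i : dom i (base xi) -> base xi = base xi' ->
  comp xi i = comp xi' i -> xi = xi'.
Proof.
case: xi xi' => x p po pc [x' p' po' pc'] /= ix xx'; case: x' / xx' in po' pc' *.
move=> E; have pp' : p = p'.
  apply/funext => j; have [jx|njx] := pselect (dom j x).
    by rewrite (pc j i) // (pc' j i) // E.
  by rewrite po // po'.
by case: p' / pp' in po' pc' E *; congr Covector; exact: Prop_irrelevance.
Qed.

Lemma covector_exists i x (p : 'rV[R]_n) : dom i x ->
  exists2 xi, base xi = x & comp xi i = p.
Proof.
(* The components are transported from chart [i] by its Jacobian matrices; compatibility between the
   other charts is the cocycle rule [tjac_comp]. *)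
move=> ix; pose q j := if `[< dom j x >] then p *m (tjac j i (coord j x))^T else 0.
have qo j : ~ dom j x -> q j = 0 by move=> jx; rewrite /q asboolF.
have qc j k : dom j x -> dom k x -> q j = q k *m (tjac j k (coord j x))^T.
  move=> jx kx; rewrite /q (asboolT jx) (asboolT kx) -mulmxA -trmx_mul.
  exact: (congr1 (fun B : 'M[R]_n => p *m B^T) (tjac_comp mA jx kx ix)).
exists (Covector qo qc) => //=.
have ciy : cod i (coord i x) by exists x.
by rewrite /q (asboolT ix) (tjac_id mA ciy) trmx1 mulmx1.
Qed.

Lemma covector_coord i z : cylinder (cod i) z ->
  exists2 xi, dom i (base xi) & cot_coord i xi = z.
Proof.
move=> [x ix xz]; have [xi bx cx] := covector_exists (rsubmx z) ix.
by exists xi; rewrite ?bx // /cot_coord bx cx xz hsubmxK.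
Qed.

Lemma cot_coord_inj i xi xi' : dom i (base xi) -> dom i (base xi') ->
  cot_coord i xi = cot_coord i xi' -> xi = xi'.
Proof.
move=> ix ix' /eq_row_mx[bb cc]; apply: (covector_ext (i := i)) cc => //.
exact: (coord_inj mA ix ix' bb).
Qed.

Lemma cot_codE i : cod (A := cot_atlas A) i = cylinder (cod i).
Proof.
apply/seteqP; split=> z.
  by move=> [xi ix <-]; rewrite /cylinder /= row_mxKl; exists (base xi).
by move=> /covector_coord[xi ix <-]; exists xi.
Qed.

Lemma cot_overlapE i j : overlap (A := cot_atlas A) i j = cylinder (overlap i j).
Proof.
apply/seteqP; split=> z.
  by move=> [xi [ix jx] <-]; rewrite /cylinder /= row_mxKl; exists (base xi).
move=> oz; have [xi ix xz] := covector_coord (overlap_sub oz).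
exists xi => //; split=> //=; move: oz; rewrite /cylinder -xz /= row_mxKl.
by move=> [x [ix' jx] /(coord_inj mA ix' ix) <-].
Qed.

(** Covector components change by the inverse Jacobian matrix, here taken from the reverse
    transition at the new point, so that its smoothness is that of a composition. *)
Definition cot_change i j z : 'rV[R]_(n + n) :=
  row_mx (transition i j (lsubmx z))
    (rsubmx z *m (tjac j i (transition i j (lsubmx z)))^T).

Lemma cot_changeE i j xi : dom i (base xi) -> dom j (base xi) ->
  cot_change i j (cot_coord i xi) = cot_coord j xi.
Proof.
move=> ix jx; rewrite /cot_change row_mxKl row_mxKr (transition_coord mA ix jx).
by rewrite -comp_change.
Qed.

Lemma cot_transitionE i j z : cylinder (overlap i j) z ->
  transition (A := cot_atlas A) i j z = cot_change i j z.
Proof.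
rewrite -cot_overlapE => -[xi [ix jx] <-]; rewrite cot_changeE //.
rewrite /transition; case: xgetP => [w -> [xi' [ix' jx' E] <-]|/(_ (cot_coord j xi))].
  by rewrite (cot_coord_inj ix' ix E).
by case; exists xi.
Qed.

Lemma smooth_tjac_inv i j :
  smooth (overlap i j) (fun y => tjac j i (transition i j y)).
Proof.
have H y : overlap i j y -> overlap j i (transition i j y) by exact: transition_cod.
exact: (smooth_comp (open_overlap mA i j) (open_overlap mA j i) H
  (smooth_transition mA i j) (smooth_tjac mA j i)).
Qed.

Lemma smooth_cot_change i j : smooth (cylinder (overlap i j)) (cot_change i j).
Proof.
have oo := open_overlap mA i j; have oO := open_cylinder oo.
apply: smooth_row_mx => //; first by apply: (smooth_base oo); exact: smooth_transition.
apply: smooth_mulmx => //; first exact: smooth_rsubmx.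
apply: smooth_trmx => //.
exact: (smooth_base oo (f := fun y => tjac j i (transition i j y))) (@smooth_tjac_inv i j).
Qed.

Lemma open_cot_chart i (O : set 'rV[R]_(n + n)) : open O ->
  open [set xi | dom i (base xi) /\ O (cot_coord i xi)].
Proof.
move=> oO; set W := (X in open X).
exists [set W]; last by rewrite bigcup_set1.
by move=> _ ->; apply: finI_from1; exists i, O.
Qed.

Lemma cot_coord_continuous i xi : dom i (base xi) ->
  {for xi, continuous (@cot_coord R n M A i)}.
Proof.
move=> ix W; rewrite nbhsE => -[B [oB Bxi] BW].
have nB : nbhs xi [set xi | dom i (base xi) /\ B (cot_coord i xi)].
  by apply: open_nbhs_nbhs; split => //; exact: open_cot_chart.
by apply: filterS nB => xi' [_ /BW].
Qed.

(* The image of [nbhs z] under the inverse of the chart [i], which is only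
   partially defined. *)
Definition chart_nbhs i z : set_system (cotangent A) :=
  [set W | nbhs z [set z' | forall xi, dom i (base xi) -> cot_coord i xi = z' -> W xi]].

Lemma chart_nbhs_filter i z : Filter (chart_nbhs i z).
Proof.
split=> [|P Q FP FQ|P Q PQ FP].
- by apply: (@filterE _ (nbhs z)) => z' xi _ _.
- apply: (@filterS2 _ (nbhs z)) FP FQ => z' Pz Qz xi ix E.
  by split; [exact: Pz | exact: Qz].
- by apply: (@filterS _ (nbhs z)) FP => z' Pz xi ix E; exact/PQ/Pz.
Qed.

(** Openness of the chart map in filter form. Since [chart_nbhs] is a filter, a subbasic set of a
    single chart [j] is enough, and for it the claim is the continuity of [cot_change i j]. *)
Lemma nbhs_chart i xi W : dom i (base xi) -> nbhs xi W -> chart_nbhs i (cot_coord i xi) W.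
Proof.
move=> ix; rewrite nbhsE => -[B [oB Bxi] BW].
have FF := chart_nbhs_filter i (cot_coord i xi).
apply: filterS BW _; case: oB => D sD; move: Bxi => /[swap] <- [C DC Cxi].
apply: (@filterS _ _ _ C); first by move=> xi' Cxi'; exists C.
have [D' sD' CE] := sD _ DC; rewrite -CE in Cxi *.
apply: filter_bigI => E DE.
have /set_mem[j [P [oP EE]]] := sD' _ DE.
have : E xi by exact: Cxi.
rewrite EE => -[jx Pxi]; rewrite /chart_nbhs /=.
have oz : cylinder (overlap i j) (cot_coord i xi).
  by rewrite /cylinder /= row_mxKl; exact: overlap_coord.
have oo := open_cylinder (open_overlap mA i j).
have cc := smooth_continuous (@smooth_cot_change i j) oz.
have n1 : nbhs (cot_coord i xi) (cylinder (overlap i j)) by apply: open_nbhs_nbhs.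
have n2 : nbhs (cot_coord i xi) (cot_change i j @^-1` P).
  by apply: cc; apply: open_nbhs_nbhs; split => //; rewrite cot_changeE.
apply: filterS2 n1 n2 => z' oz' Pz' xi' ix' E'.
have jx' : dom j (base xi').
  move: oz'; rewrite -cot_overlapE -E' => -[xi2 [ix2 jx2] /cot_coord_inj].
  by move=> /(_ ix2 ix') <-.
by split=> //; rewrite -(cot_changeE ix' jx') E'.
Qed.

Lemma cot_coord_open i (O : set (cotangent A)) : open O ->
  O `<=` [set xi | dom i (base xi)] -> open (cot_coord i @` O).
Proof.
move=> oO sO; rewrite openE => _ [xi Oxi <-].
have ix := sO _ Oxi.
have nO : nbhs xi O by apply: open_nbhs_nbhs.
have oz : cylinder (cod i) (cot_coord i xi).
  by rewrite -cot_codE; exists xi.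
have n1 : nbhs (cot_coord i xi) (cylinder (cod i)).
  by apply: open_nbhs_nbhs; split => //; exact: open_cylinder (open_cod mA i).
have n2 := nbhs_chart ix nO.
rewrite /interior; apply: filterS2 n1 n2 => z' /covector_coord[xi' ix' E'] H.
by exists xi' => //; exact: H.
Qed.

Lemma open_base (W : set M) : open W -> open [set xi : cotangent A | W (base xi)].
Proof.
move=> oW; rewrite openE => xi Wxi; have [_ _ /(_ (base xi))[i ix] _ _] := mA.
have oC : open (coord i @` (dom i `&` W)).
  by apply: (coord_open mA) => [|x []//]; apply: openI => //; exact: open_dom.
have oW' := open_cot_chart i (open_cylinder oC).
have : nbhs xi [set xi | dom i (base xi) /\ cylinder (coord i @` (dom i `&` W)) (cot_coord i xi)].
  apply: open_nbhs_nbhs; split => //; split => //.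
  by rewrite /cylinder /= row_mxKl; exists (base xi).
apply: filterS => xi' [ix']; rewrite /cylinder /= row_mxKl => -[x [ix2 Wx] E].
by rewrite -(coord_inj mA ix2 ix' E).
Qed.

(** Covectors over different points are separated by open sets of [M], covectors over the same point
    by their coordinates in one chart. *)
Lemma cot_hausdorff : hausdorff_space (cotangent A).
Proof.
rewrite open_hausdorff => xi xi' xx'.
have [bb|/eqP bb] := pselect (base xi = base xi'); last first.
  have [hM _ _ _ _] := mA; move: hM; rewrite open_hausdorff => /(_ _ _ bb).
  move=> [[U V] /= [/set_mem Ux /set_mem Vx] [oU oV /eqP UV]].
  exists ([set xi | U (base xi)], [set xi | V (base xi)]) => /=.
    by split; apply/mem_set.
  split; [exact: open_base | exact: open_base|].
  apply/eqP/seteqP; split=> // xi2 [U2 V2].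
  by have : (U `&` V) (base xi2) by []; rewrite UV.
have [_ _ /(_ (base xi))[i ix] _ _] := mA.
have ix' : dom i (base xi') by rewrite -bb.
have cc : cot_coord i xi != cot_coord i xi'.
  by apply: contra_neq xx' => /(cot_coord_inj ix ix').
have := @norm_hausdorff R 'rV[R]_(n + n); rewrite open_hausdorff => /(_ _ _ cc).
move=> [[U V] /= [/set_mem Ux /set_mem Vx] [oU oV /eqP UV]].
exists ([set xi | dom i (base xi) /\ U (cot_coord i xi)],
        [set xi | dom i (base xi) /\ V (cot_coord i xi)]) => /=.
  by split; apply/mem_set.
split; [exact: open_cot_chart | exact: open_cot_chart|].
apply/eqP/seteqP; split=> // xi2 [[_ U2] [_ V2]].
by have : (U `&` V) (cot_coord i xi2) by []; rewrite UV.
Qed.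

(** The atlas may have uncountably many charts. One chart is chosen for each basic open set of [M]
    that lies in some chart domain, and only these charts are used to cut out basic sets. *)
Lemma cot_second_countable : @second_countable (cotangent A).
Proof.
have [_ [B cB [oB bB]] cov _ _] := mA.
have [Q cQ [oQ bQ]] := @row_second_countable R (n + n).
have fE (b : set M) : exists oi : option (idx A), match oi with
    | Some i => b `<=` dom i | None => ~ exists i, b `<=` dom i end.
  have [[i bi]|ni] := pselect (exists i, b `<=` dom i); first by exists (Some i).
  by exists None.
have [f fP] := boolp.choice fE.
(* The covectors over the basic set that lie, in its chosen chart, in the given basic set of
   coordinates. *)
pose S (bq : set M * set 'rV[R]_(n + n)) : set (cotangent A) := match f bq.1 with
  | Some i => [set xi | bq.1 (base xi) /\ (dom i (base xi) /\ bq.2 (cot_coord i xi))]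
  | None => set0 end.
exists [set S bq | bq in B `*` Q].
  by apply: (card_le_trans (card_image_le _ _)); exact: countableX.
split=> [_ [[b q] [/= /oB ob /oQ oq] <-]|xi W nW].
  rewrite /S /=; case: (f b) => [i|]; last exact: open0.
  by apply: openI; [exact: open_base | exact: open_cot_chart].
have [i ix] := cov (base xi).
have [b [Bb bx] bi] : filter_from [set U | B U /\ U (base xi)] id (dom i).
  by apply: bB; apply: open_nbhs_nbhs; split => //; exact: open_dom.
have := fP b; case fb : (f b) => [k|]; last by case; exists i.
move=> bk; have kx : dom k (base xi) by exact: bk.
have [q [Qq qx] qW] := bQ _ _ (nbhs_chart kx nW).
exists (S (b, q)); first by split; [exists (b, q) | rewrite /S /= fb].
by rewrite /S /= fb => xi' [_ [kx' /qW]] /(_ _ kx' erefl).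
Qed.

Lemma cot_is_manifold : is_manifold (cot_atlas A).
Proof.
split; [exact: cot_hausdorff | exact: cot_second_countable | | |].
- move=> xi; have [_ _ /(_ (base xi))[i ix] _ _] := mA; by exists i.
- move=> i; split.
  + exact: (open_base (open_dom mA (i : idx A))).
  + by move=> xi xi' /set_mem ix /set_mem ix'; exact: cot_coord_inj.
  + exact: (@cot_coord_continuous i).
  + exact: (@cot_coord_open i).
- move=> i j; rewrite cot_overlapE.
  have oO := open_cylinder (open_overlap mA i j).
  by apply: (smooth_congr oO) (@smooth_cot_change i j) => z oz; rewrite cot_transitionE.
Qed.

End CotangentManifold.

(** * Tensor fields on the cotangent bundle *)

Section CotangentTensorLaws.
Context {R : realType} {n : nat} {M : topologicalType} (A : atlas R n M).
Hypothesis mA : is_manifold A.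
Variable g : mx_field A.
Hypothesis tg : is_tensor02 g.
Hypothesis gs : forall i y, cod i y -> (g i y)^T = g i y.
Hypothesis gu : forall i y, cod i y -> g i y \in unitmx.
Implicit Types (i j : idx A) (y : 'rV[R]_n) (z : 'rV[R]_(n + n)).

Let K i j y := tjac j i (transition i j y).

(** Differentiate the identity [tjac i j y *m K i j y = 1%:M], which holds on the whole overlap. *)
Lemma pd_tjac_inv i j y a : overlap i j y ->
  pd (K i j) y a = - (K i j y *m pd (tjac i j) y a *m K i j y).
Proof.
move=> oy; have TK : tjac i j y *m K i j y = 1%:M := tjacK mA oy.
have KT : K i j y *m tjac i j y = 1%:M := tjacVK mA oy.
have dT := smooth_differentiable (smooth_tjac mA i j) oy.
have dK : differentiable (K i j) y := smooth_differentiable (smooth_tjac_inv mA i j) oy.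
have E : pd (tjac i j) y a *m K i j y + tjac i j y *m pd (K i j) y a = 0.
  apply: etrans (esym (derive_mulmx (delta_mx 0 a) dT dK)) _.
  rewrite -(derive_cst (1%:M : 'M[R]_n) y (delta_mx 0 a)).
  apply: near_eq_derive; apply: (open_near_eq (open_overlap mA i j) _ oy) => u ou.
  exact: (tjacK mA ou).
have := congr1 (mulmx (K i j y)) E; rewrite mulmxDr !mulmxA KT mul1mx mulmx0.
by move=> /eqP; rewrite addrC addr_eq0 => /eqP.
Qed.

Definition tjac_fiber i j z : 'M[R]_n :=
  \matrix_(a, b) (rsubmx z *m (pd (K i j) (lsubmx z) a)^T) 0 b.

Lemma derive_cot_change i j z v : cylinder (overlap i j) z ->
  'D_v (cot_change i j) z =
  row_mx (lsubmx v *m tjac i j (lsubmx z))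
    (rsubmx v *m (K i j (lsubmx z))^T
     + rsubmx z *m ('D_(lsubmx v) (K i j) (lsubmx z))^T).
Proof.
move=> oz; have df := differentiable_transition mA oz.
have dK : differentiable (K i j) (lsubmx z) :=
  smooth_differentiable (smooth_tjac_inv mA i j) oz.
have dr := @differentiable_rsubmx R 1 n n z.
have dKb := differentiable_base dK; have dKt := differentiable_trmx dKb.
have [_ E] := derive_row_mx v (differentiable_base df) (differentiable_mulmx dr dKt).
apply: etrans E _; congr row_mx.
  by rewrite derive_lsubmx // deriveEjacobian.
rewrite (derive_mulmx _ dr dKt) derive_rsubmx (derive_trmx _ dKb).
by rewrite (derive_lsubmx _ dK).
Qed.

Lemma cot_tjac_block i j z : cylinder (overlap i j) z ->
  tjac (A := cot_atlas A) i j z =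
  block_mx (tjac i j (lsubmx z)) (tjac_fiber i j z) 0 (K i j (lsubmx z))^T.
Proof.
move=> oz; have oO := open_cylinder (open_overlap mA i j).
have dc := smooth_differentiable (smooth_cot_change mA i j) oz.
have E1 : tjac (A := cot_atlas A) i j z = 'J (cot_change i j) z.
  symmetry; apply: near_eq_jacobian dc.
  by apply: (open_near_eq oO _ oz) => w ow; rewrite cot_transitionE.
rewrite E1; apply/row_matrixP => k; rewrite [LHS]rowE -(deriveEjacobian _ dc).
rewrite (derive_cot_change _ oz).
case: (fintype.splitP k) => a Ea; [have {Ea}-> : k = lshift n a by exact: val_inj |
  have {Ea}-> : k = rshift n a by exact: val_inj].
  rewrite lsubmx_deltal rsubmx_deltal mul0mx add0r /block_mx rowKu row_row_mx -rowE.
  by congr row_mx; apply/rowP => b; rewrite [RHS]mxE [RHS]mxE.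
rewrite lsubmx_deltar rsubmx_deltar mul0mx derive0 trmx0 mulmx0 addr0.
by rewrite /block_mx rowKd row_row_mx row0 -rowE.
Qed.

Lemma frame_mx_row i z a : cod i (lsubmx z) ->
  row a (frame_mx (g i) z) = rsubmx z *m (christoffel_mx (g i) (lsubmx z) a)^T.
Proof.
move=> iz; apply/rowP => l; rewrite mxE frame_mxE !mxE; apply: eq_bigr => h _.
have [Cg _] := tg; rewrite [_^T h a]mxE [_^T h l]mxE; congr (_ * _).
exact: (christoffel_torsion_free (open_cod mA i) (Cg i) (@gs i) (@gu i) iz).
Qed.

Lemma change_inv (T L B dT S : 'M[R]_n) : T *m L = 1%:M -> L *m T = 1%:M ->
  B *m T = dT + T *m S -> - (L *m dT *m L) + L *m B = S *m L.
Proof.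
move=> TL LT /(congr1 (fun C => L *m C *m L)).
rewrite mulmxDr mulmxDl -!mulmxA TL mulmx1 => ->.
by rewrite addrA addNr add0r !mulmxA LT mul1mx.
Qed.

(** The upper right block of the comparison of adapted frames: [adapted_frame] of chart [i] times
    the Jacobian matrix equals [change_mx] times [adapted_frame] of chart [j]. *)
Lemma frame_change i j z : cylinder (overlap i j) z ->
  tjac_fiber i j z + frame_mx (g i) z *m (K i j (lsubmx z))^T =
  tjac i j (lsubmx z) *m frame_mx (g j) (cot_change i j z).
Proof.
move=> oz; have iz := overlap_sub oz; have oz' := transition_cod mA oz.
have jz := overlap_sub oz'.
have ccl : lsubmx (cot_change i j z) = transition i j (lsubmx z) by rewrite row_mxKl.
have ccr : rsubmx (cot_change i j z) = rsubmx z *m (K i j (lsubmx z))^T by rewrite row_mxKr.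
have jz' : cod j (lsubmx (cot_change i j z)) by rewrite ccl.
have TK : tjac i j (lsubmx z) *m K i j (lsubmx z) = 1%:M := tjacK mA oz.
have KT : K i j (lsubmx z) *m tjac i j (lsubmx z) = 1%:M := tjacVK mA oz.
apply/row_matrixP => a; rewrite linearD /= !row_mul frame_mx_row //.
have -> : row a (tjac_fiber i j z) = rsubmx z *m (pd (K i j) (lsubmx z) a)^T.
  by apply/rowP => b; rewrite 2!mxE.
rewrite [row a (tjac _ _ _)]row_sum_delta mulmx_suml.
under eq_bigr => c _ do rewrite -scalemxAl -rowE (frame_mx_row _ jz') ccl ccr mxE.
(* Row [a] on the left is now [rsubmx z] times the transpose of a matrix; [change_inv] shows that
   this matrix is the Christoffel law multiplied by the inverse Jacobian on both sides. *)
rewrite -mulmxA -trmx_mul -mulmxDr -trmxD (pd_tjac_inv _ oz).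
have E := christoffel_change mA tg (@gs) (@gu) a oz.
have ES : \sum_c tjac i j (lsubmx z) a c *: (tjac i j (lsubmx z) *m
      christoffel_mx (g j) (transition i j (lsubmx z)) c) =
    tjac i j (lsubmx z) *m \sum_c tjac i j (lsubmx z) a c *:
      christoffel_mx (g j) (transition i j (lsubmx z)) c.
  by rewrite mulmx_sumr; apply: eq_bigr => c _; rewrite scalemxAr.
rewrite ES in E; rewrite (change_inv TK KT E) mulmx_suml raddf_sum mulmx_sumr.
apply: eq_bigr => c _.
by rewrite /= -scalemxAl trmxZ -scalemxAr trmx_mul mulmxA.
Qed.

Definition change_mx i j y : 'M[R]_(n + n) := block_mx (tjac i j y) 0 0 (K i j y)^T.

Lemma frame_tjac i j z : cylinder (overlap i j) z ->
  tjac (A := cot_atlas A) i j z =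
  invmx (adapted_frame (g i) (lsubmx z) (rsubmx z)) *m change_mx i j (lsubmx z) *m
  adapted_frame (g j) (lsubmx (cot_change i j z)) (rsubmx (cot_change i j z)).
Proof.
move=> oz; rewrite !adapted_frame_block invmx_frame cot_tjac_block // /change_mx.
rewrite !mulmx_block !(mul1mx, mulmx1, mul0mx, mulmx0, addr0, add0r).
by congr block_mx; rewrite -frame_change // mulNmx addrK.
Qed.

(** Once the Jacobian matrix is written with [frame_tjac], the frames telescope and the tensor law
    reduces to one for block matrices under [C]; [congr_mxM] does the same for (0,2)-tensors. *)
Lemma conj_mxM m (F F' C D D' : 'M[R]_m) : F \in unitmx -> F' \in unitmx ->
  D *m C = C *m D' ->
  invmx F *m D *m F *m (invmx F *m C *m F') =
  invmx F *m C *m F' *m (invmx F' *m D' *m F').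
Proof.
move=> uF uF' DC.
by rewrite !mulmxA !mulmxK // -[invmx F *m D *m C]mulmxA DC mulmxA.
Qed.

Lemma congr_mxM m (F F' C B B' : 'M[R]_m) : F \in unitmx -> F' \in unitmx ->
  B = C *m B' *m C^T ->
  invmx F *m B *m (invmx F)^T =
  invmx F *m C *m F' *m (invmx F' *m B' *m (invmx F')^T) *m (invmx F *m C *m F')^T.
Proof.
move=> uF uF' ->; rewrite !trmx_mul !mulmxA mulmxK //.
by rewrite -[_ *m (invmx F')^T *m F'^T]mulmxA -trmx_mul mulmxV // trmx1 mulmx1.
Qed.

Lemma lsubmx_cot_change i j z : lsubmx (cot_change i j z) = transition i j (lsubmx z).
Proof. exact: row_mxKl. Qed.

Lemma horizontal_lift_tensor (J : mx_field A) : is_tensor11 J ->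
  is_tensor11 (A := cot_atlas A) (horizontal_lift g J).
Proof.
move=> [CJ lJ]; have [Cg _] := tg; split.
  move=> i; rewrite (cot_codE mA); exact: (smooth_hlift (open_cod mA i) (Cg i) (@gs i) (@gu i) (CJ i)).
move=> i j z; rewrite (cot_overlapE mA) => oz.
rewrite (cot_transitionE mA oz) (frame_tjac oz) /horizontal_lift /hlift_mx.
apply: conj_mxM; try exact: adapted_frame_unit.
rewrite lsubmx_cot_change.
rewrite /change_mx !mulmx_block !(mul0mx, mulmx0, addr0, add0r) lJ //.
rewrite -!trmx_mul; congr (block_mx _ _ _ (_^T)).
(* The fibre block is the transposed law of [J] for the reverse change of coordinates. *)
have oz' := transition_cod mA oz.
have E := lJ j i _ oz'; rewrite (transitionK mA oz) in E.
exact: esym E.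
Qed.

Lemma riem_ext_tensor (c : mx_field A) : is_tensor02 c ->
  is_tensor02 (A := cot_atlas A) (riem_ext g c).
Proof.
move=> [Cc lc]; have [Cg _] := tg; split.
  move=> i; rewrite (cot_codE mA); exact: (smooth_riem_ext (open_cod mA i) (Cg i) (@gs i) (@gu i) (Cc i)).
move=> i j z; rewrite (cot_overlapE mA) => oz.
rewrite (cot_transitionE mA oz) (frame_tjac oz) /riem_ext /riem_ext_mx.
apply: congr_mxM; try exact: adapted_frame_unit.
rewrite lsubmx_cot_change.
have TK := tjacK mA oz.
rewrite /change_mx tr_block_mx !mulmx_block !(mul0mx, mulmx0, mul1mx, mulmx1, addr0, add0r, trmx0, trmxK).
by rewrite TK -trmx_mul TK trmx1 -lc.
Qed.

End CotangentTensorLaws.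

(** * The equivalence *)

Section BilinearForms.
Context {R : realType} {n : nat}.
Implicit Types (B C J : 'M[R]_n).

Lemma bil_inj B C : (forall v w, bil B v w = bil C v w) -> B = C.
Proof. by move=> BC; apply/matrixP => i j; rewrite -!bil_delta BC. Qed.

Lemma bil_symP B : (forall v w, bil B v w = bil B w v) <-> B^T = B.
Proof.
have bilT v w : bil B^T v w = bil B w v by rewrite /bil -[LHS]trmxE !dist_mxE.
split=> [H|BT v w]; first by apply: bil_inj => v w; rewrite bilT.
by rewrite -bilT BT.
Qed.

Lemma bil_pureP B J :
  (forall v w, bil B (v *m J) w = bil B v (w *m J)) <-> J *m B = B *m J^T.
Proof.
have bl v w : bil B (v *m J) w = bil (J *m B) v w by rewrite /bil !mulmxA.
have br v w : bil B v (w *m J) = bil (B *m J^T) v w by rewrite /bil trmx_mul !mulmxA.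
split=> [H|JB v w]; last by rewrite bl br JB.
by apply: bil_inj => v w; rewrite -bl -br.
Qed.

Lemma neutral_signature_unit B : neutral_signature B -> B \in unitmx.
Proof.
move=> [P uP E]; have : P *m B *m P^T \in unitmx.
  rewrite E unitmxE det_diag unitfE; apply/prodf_neq0 => j _; rewrite mxE.
  by case: ifP => _; rewrite ?oppr_eq0 oner_neq0.
by rewrite !unitmx_mul unitmx_tr uP andbT.
Qed.

Lemma riem_ext_block_neutral (c N : 'M[R]_n) : c^T = c ->
  neutral_signature (riem_ext_block c N).
Proof.
move=> cs; set q := c - N - N^T.
have qs : q^T = q by rewrite /q !(trmxD, trmxN, trmxK) cs addrAC.
(* [a] and [b] solve q + 2a = 1 and q + 2b = -1; then the mixed block q + a + b vanishes as well. *)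
pose a := 2^-1 *: (1%:M - q); pose b := 2^-1 *: (- 1%:M - q).
have as' : a^T = a by rewrite /a trmxZ trmxD trmxN trmx1 qs.
have bs : b^T = b by rewrite /b trmxZ trmxD !trmxN trmx1 qs.
pose P : 'M[R]_(n + n) := block_mx 1%:M a 1%:M b.
pose D : 'M[R]_(n + n) := block_mx 1%:M 0 0 (- 1%:M).
have E : P *m riem_ext_block c N *m P^T = D.
  rewrite /P /riem_ext_block -/q tr_block_mx !mulmx_block.
  rewrite !(mul1mx, mulmx1, mul0mx, mulmx0, addr0, add0r, trmx1) as' bs.
  by congr block_mx; apply/matrixP => i j; rewrite /a /b !zmxE; field.
exists P.
  (* [P] is invertible because [D] is an involution: squaring [E] exhibits a right inverse of
     [P]. *)
  have DD : D *m D = 1%:M.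
    rewrite /D mulmx_block !(mul1mx, mulmx1, mul0mx, mulmx0, addr0, add0r).
    by rewrite mulNmx mulmxN opprK mulmx1 -scalar_mx_block.
  move: DD; rewrite -{1}E -!mulmxA => /mulmx1_unit[] //.
rewrite E /D; apply/matrixP => i j.
have nn : ((n + n)./2 = n)%N by rewrite addnn doubleK.
case: (fintype.splitP i) => i' Ei; [have {Ei}-> : i = lshift n i' by exact: val_inj |
  have {Ei}-> : i = rshift n i' by exact: val_inj];
(case: (fintype.splitP j) => j' Ej; [have {Ej}-> : j = lshift n j' by exact: val_inj |
  have {Ej}-> : j = rshift n j' by exact: val_inj]).
- by rewrite block_mxEul !mxE nn /= ltn_ord eq_lshift.
- by rewrite block_mxEur !mxE eq_lrshift.
- by rewrite block_mxEdl !mxE eq_rlshift.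
- by rewrite block_mxEdr !mxE nn /= ltnNge leq_addr eq_rshift /= mulNrn.
Qed.

End BilinearForms.

Section KahlerNordenCotangent.
Context {R : realType} {n : nat} {M : topologicalType} (A : atlas R n M).
Variables J g c : mx_field A.
Hypothesis MJg : kahler_norden J g.
Hypothesis c_tensor : is_tensor02 c.
Hypothesis c_sym : symmetric_tensor c.

(** Stated for an arbitrary atlas, since it is applied both to [M] and to its cotangent bundle.
    Constant fields on a whole chart are test fields enough. *)
Lemma parallel_of_nabla (N : nat) (M' : topologicalType) (A' : atlas R N M')
   (J' g' : mx_field A') i y : is_manifold A' -> is_tensor11 J' -> cod i y ->
  (forall i U X Y, local_fields (A := A') i U X -> local_fields (A := A') i U Y ->
    forall y, U y ->
      levi_civita (g' i) X (act (J' i) Y) y = act (J' i) (levi_civita (g' i) X Y) y) ->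
  forall a, pd (J' i) y a + J' i y *m christoffel_mx (g' i) y a
     - christoffel_mx (g' i) y a *m J' i y = 0.
Proof.
move=> mA' [CJ' _] iy H.
apply/(parallelP (g' i) (smooth_differentiable (CJ' i) iy)) => a b.
have lf v : local_fields (A := A') i (cod i) (cst v).
  by split => //; [exact: open_cod | exact: smooth_cst].
exact: H iy.
Qed.

Let mA : is_manifold A. Proof. by case: MJg => -[[]]. Qed.
Let tJ : is_tensor11 J. Proof. by case: MJg => -[_ []]. Qed.
Let tg : is_tensor02 g. Proof. by case: MJg => -[_ _ []]. Qed.
Let JJ i y : cod i y -> J i y *m J i y = - 1%:M.
Proof. by case: MJg => -[_ [_ H] _ _ _] _; exact: H. Qed.
Let gs i y : cod i y -> (g i y)^T = g i y.
Proof. by case: MJg => -[_ _ [_ H] _ _] _ /H /bil_symP. Qed.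
Let gu i y : cod i y -> g i y \in unitmx.
Proof. by case: MJg => -[_ _ _ H _] _ /H /neutral_signature_unit. Qed.
Let gp i y : cod i y -> J i y *m g i y = g i y *m (J i y)^T.
Proof. by case: MJg => -[_ _ _ _ H] _ /H /bil_pureP. Qed.
Let nJ i y a : cod i y -> pd (J i) y a + J i y *m christoffel_mx (g i) y a
     - christoffel_mx (g i) y a *m J i y = 0.
Proof. by case: MJg => _ H iy; exact: parallel_of_nabla. Qed.
Let cs i y : cod i y -> (c i y)^T = c i y.
Proof. by move=> /c_sym /bil_symP. Qed.

Let parallel_iff i z : cylinder (cod i) z ->
  J i (lsubmx z) *m c i (lsubmx z) = c i (lsubmx z) *m (J i (lsubmx z))^T ->
  (forall k, pd (horizontal_lift g J i) z k
     + horizontal_lift g J i z *m christoffel_mx (riem_ext g c i) z k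
     - christoffel_mx (riem_ext g c i) z k *m horizontal_lift g J i z = 0) <->
  (forall a, pd (J i) (lsubmx z) a *m c i (lsubmx z)
     + J i (lsubmx z) *m koszul (pd (c i) (lsubmx z)) a
     = koszul (pd (c i) (lsubmx z)) a *m (J i (lsubmx z))^T).
Proof.
move=> iz cp; have [[CJ _] [Cg _] [Cc _]] := And3 tJ tg c_tensor.
exact: (chart_parallel (open_cod mA i) (Cg i) (@gs i) (@gu i) (CJ i) (Cc i)
  (@nJ i) (@gp i) iz (cs iz) cp).
Qed.

Let tachibana_iff i y : pure J c -> cod i y ->
  (forall a, pd (J i) y a *m c i y + J i y *m koszul (pd (c i) y) a
     = koszul (pd (c i) y) a *m (J i y)^T) <->
  (forall k l m, tachibana_coef (J i y) (c i y) (pd (J i) y) (pd (c i) y) k l m = 0).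
Proof.
move=> cp iy; have [[CJ _] [Cc _]] := conj tJ c_tensor.
have dJ := smooth_differentiable (CJ i) iy; have dc := smooth_differentiable (Cc i) iy.
apply: koszul_tachibana_iff; first exact: cs.
  by move=> a; exact: (pd_trmx_id (open_cod mA i) a (Cc i) (@cs i) iy).
move=> a; have dJT := differentiable_trmx dJ.
apply: etrans (esym (derive_mulmx (delta_mx 0 a) dJ dc)) _.
rewrite -(derive_trmx _ dJ); apply: etrans _ (derive_mulmx (delta_mx 0 a) dc dJT).
apply: near_eq_derive; apply: (open_near_eq (open_cod mA i) _ iy) => z iz.
by apply/bil_pureP; exact: cp.
Qed.

Lemma holomorphic_of_kahler :
  kahler_norden (A := cot_atlas A) (horizontal_lift g J) (riem_ext g c) ->
  holomorphic J c.
Proof.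
move=> [[[mC _] [tC _] _ _ pC] nC].
have cp : pure J c.
  move=> i y iy v w.
  (* Purity at the zero covector over [y], tested on horizontal lifts, is purity of [c] at [y]. *)
  have iz : cod (A := cot_atlas A) i (row_mx y 0).
    by rewrite (cot_codE mA) /cylinder /= row_mxKl.
  have := pC i _ iz (hlift (g i) y 0 v) (hlift (g i) y 0 w).
  by rewrite !hlift_mx_hlift !riem_ext_hh.
split=> // i U X Y Z [oU Ui CX] [_ _ CY] [_ _ CZ] y Uy.
have iy := Ui _ Uy; have [[CJ _] [Cc _]] := conj tJ c_tensor.
have iz : cod (A := cot_atlas A) i (row_mx y 0).
  by rewrite (cot_codE mA) /cylinder /= row_mxKl.
have par := parallel_of_nabla mC tC iz nC.
have iz' : cylinder (cod i) (row_mx y 0 : 'rV[R]_(n + n)) by rewrite -(cot_codE mA).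
have cpy : J i y *m c i y = c i y *m (J i y)^T by apply/bil_pureP; exact: cp.
have := parallel_iff iz'; rewrite row_mxKl => /(_ cpy) [H _].
have /(tachibana_iff cp iy) T0 := H par.
rewrite tachibana_coefE //.
- by apply: big1 => k _; apply: big1 => l _; apply: big1 => m _; rewrite T0 mulr0.
- exact: smooth_differentiable (CJ i) iy.
- exact: smooth_differentiable (Cc i) iy.
- exact: smooth_differentiable CX Uy.
- exact: smooth_differentiable CY Uy.
- exact: smooth_differentiable CZ Uy.
- exact: cs.
Qed.

Lemma kahler_of_holomorphic : holomorphic J c ->
  kahler_norden (A := cot_atlas A) (horizontal_lift g J) (riem_ext g c).
Proof.
move=> [cp hol]; have [[CJ _] [Cc _]] := conj tJ c_tensor.
have tC := horizontal_lift_tensor mA tg (@gs) (@gu) tJ.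
have cpm i y : cod i y -> J i y *m c i y = c i y *m (J i y)^T.
  by move=> iy; apply/bil_pureP; exact: cp.
split; first split.
- split; first exact: cot_is_manifold.
  by rewrite addnn odd_double.
- split=> // i z; rewrite (cot_codE mA) => iz.
  by rewrite /horizontal_lift hlift_mx_block hlift_block_sq // JJ.
- split; first exact: riem_ext_tensor.
  move=> i z; rewrite (cot_codE mA) => iz; apply/bil_symP.
  by rewrite /riem_ext riem_ext_mx_block riem_ext_block_sym // cs.
- move=> i z; rewrite (cot_codE mA) => iz.
  by rewrite /riem_ext riem_ext_mx_block; apply: riem_ext_block_neutral; exact: cs.
- move=> i z; rewrite (cot_codE mA) => iz; apply/bil_pureP.
  rewrite /riem_ext /horizontal_lift riem_ext_mx_block hlift_mx_block hlift_block_pure //.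
  exact: cpm.
move=> i U X Y [oU Ui CX] [_ _ CY] z Uz.
have iz := Ui _ Uz; have [CtC _] := tC.
have dJ := smooth_differentiable (CtC i) iz.
have iz' := iz; rewrite (cot_codE mA) in iz'.
have lf v : local_fields (A := A) i (@cod _ _ _ A i) (cst v).
  by split => //; [exact: open_cod | exact: smooth_cst].
apply/eqP; rewrite -subr_eq0 nabla_J //; last exact: smooth_differentiable CY Uz.
rewrite big1 ?mulmx0 // => k _.
suff -> : pd (horizontal_lift g J i) z k
     + horizontal_lift g J i z *m christoffel_mx (riem_ext g c i) z k
     - christoffel_mx (riem_ext g c i) z k *m horizontal_lift g J i z = 0 by rewrite scaler0.
(* The matrix condition at [z] is traded for the vanishing of the Tachibana coefficients at the base
   point, where [hol] is applied to constant fields. *)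
move: k; apply/(parallel_iff iz' (cpm _ _ iz')); apply/(tachibana_iff cp iz') => k l m.
rewrite -tachibana_delta.
- exact: (hol _ _ _ _ _ (lf _) (lf _) (lf _) _ iz').
- exact: smooth_differentiable (CJ i) iz'.
- exact: smooth_differentiable (Cc i) iz'.
- exact: cs.
- exact: cpm.
Qed.

End KahlerNordenCotangent.

Theorem theorem1 (R : realType) (n : nat) (M : topologicalType)
    (A : atlas R n M) (J g c : mx_field A)
    (n_ge4 : (4 <= n)%N)
    (MJg : kahler_norden J g)
    (c_tensor : is_tensor02 c)
    (c_sym : symmetric_tensor c) :
  kahler_norden (A := cot_atlas A) (horizontal_lift g J) (riem_ext g c) <->
  holomorphic J c.
Proof.
by split; [exact: holomorphic_of_kahler | exact: kahler_of_holomorphic].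
Qed.
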